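(* Under Assumptions 1–3, assume $r_\ell<\min\{m_\ell,n_\ell\}$ for all $\ell$ and $\Delta>0$. Let $T$ be an integer with $T\ge 2+128/(3\underline\delta)+(128\sigma)^2/(9\sqrt{\underline\delta}L\Delta)$ and choose $\beta_1=\Big(1+\sqrt{\tfrac{\underline\delta^{3/2}\sigma^2T}{L\Delta}}\Big)^{-1}$, $\tau=\lceil 64/(3\underline\delta\beta_1)\rceil$, $\mathcal B=\lceil 1/(\underline\delta\beta_1)\rceil$, and $\eta=\Big(4L+\sqrt{\tfrac{80L^2}{3\underline\delta\beta_1^2}}+\sqrt{\tfrac{40\tau^2L^2}{\underline\delta}}+\sqrt{\tfrac{32\tau L^2}{3\beta_1}}\Big)^{-1}$. Then GaLore using large-batch stochastic gradients and MSGD with momentum projection satisfies $\frac1T\sum_{t=0}^{T-1}\mathbb{E}\|\nabla f(x^{(t)})\|_2^2\le C\Big(\frac{L\Delta}{\underline\delta^{5/2}T}+\sqrt{\frac{L\Delta\sigma^2}{\underline\delta^{7/2}T}}\Big)$ for an absolute constant $C$.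
   Context: Parameters $x=(\mathrm{vec}(X_1)^\top,\dots,\mathrm{vec}(X_{N_L})^\top)^\top\in\mathbb{R}^d$, $X_\ell\in\mathbb{R}^{m_\ell\times n_\ell}$; $f(x)=\mathbb{E}_{\xi\sim\mathcal D}F(x;\xi)$; $\nabla_\ell$ is the gradient w.r.t. $X_\ell$. Assumption 1: $\inf f>-\infty$. Assumption 2: $\nabla f$ is $L$-Lipschitz in $\|\cdot\|_2$. Assumption 3: $\mathbb{E}_\xi[\nabla_\ell F(x;\xi)]=\nabla_\ell f(x)$ and $\mathbb{E}_\xi\|\nabla_\ell F(x;\xi)-\nabla_\ell f(x)\|_F^2\le\sigma_\ell^2$ for all $x,\ell$; $\sigma^2=\sum_\ell\sigma_\ell^2$. $\Delta=f(x^{(0)})-\inf f$, $\delta_\ell=r_\ell/\min\{m_\ell,n_\ell\}$, $\underline\delta=\min_\ell\delta_\ell$. Algorithm (GaLore with MSGD and momentum projection): $M_\ell^{(-1)}=0$. For $t=0,\dots,T-1$ and each $\ell$: if $t\equiv0\pmod\tau$, take an SVD $G_\ell^{(t)}=U\Sigma V^\top$ (singular values nonincreasing), $P_\ell^{(t)}=U[:,:r_\ell]$, $Q_\ell^{(t)}=V[:,:r_\ell]$; otherwise $P_\ell^{(t)}=P_\ell^{(t-1)}$, $Q_\ell^{(t)}=Q_\ell^{(t-1)}$. If $m_\ell\le n_\ell$: $M_\ell^{(t)}=(1-\beta_1)(P_\ell^{(t)})^\top P_\ell^{(t-1)}M_\ell^{(t-1)}+\beta_1(P_\ell^{(t)})^\top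 G_\ell^{(t)}$, $X_\ell^{(t+1)}=X_\ell^{(t)}-\eta P_\ell^{(t)}M_\ell^{(t)}$. If $m_\ell>n_\ell$: $M_\ell^{(t)}=(1-\beta_1)M_\ell^{(t-1)}(Q_\ell^{(t-1)})^\top Q_\ell^{(t)}+\beta_1G_\ell^{(t)}Q_\ell^{(t)}$, $X_\ell^{(t+1)}=X_\ell^{(t)}-\eta M_\ell^{(t)}(Q_\ell^{(t)})^\top$. Large-batch gradients: if $t\equiv0\pmod\tau$, draw $\xi^{(t,1)},\dots,\xi^{(t,\mathcal B)}$ i.i.d. from $\mathcal D$ and set $G_\ell^{(t)}=\frac1{\mathcal B}\sum_{b=1}^{\mathcal B}\nabla_\ell F(x^{(t)};\xi^{(t,b)})$; otherwise draw a single $\xi^{(t)}\sim\mathcal D$ and set $G_\ell^{(t)}=\nabla_\ell F(x^{(t)};\xi^{(t)})$. All samples are independent across iterations and the same samples are used for all $\ell$. *)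

(* Defs.v *)
From HB Require Import structures.
From mathcomp Require Import all_boot all_order all_algebra.
From mathcomp Require Import all_classical all_reals all_analysis.
Set Implicit Arguments. Unset Strict Implicit. Unset Printing Implicit Defensive.
Import Order.TTheory GRing.Theory Num.Theory.
Local Open Scope classical_set_scope.
Local Open Scope ring_scope.

Definition frob_inner (R : realType) (p q : nat) (A B : 'M[R]_(p, q)) : R :=
  \sum_(i < p) \sum_(j < q) A i j * B i j.
Definition frob_sq (R : realType) (p q : nat) (A : 'M[R]_(p, q)) : R :=
  frob_inner A A.

(* U[:, :r] : the first r columns of U (meaningful when r <= k). *)
Definition firstcols (R : realType) (p k r : nat) (U : 'M[R]_(p, k)) : 'M[R]_(p, r) :=
  \matrix_(i < p, j < r) \sum_(c < k | val c == val j) U i c.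

Definition is_svd (R : realType) (p q : nat) (G : 'M[R]_(p, q))
    (U : 'M[R]_p) (S : 'M[R]_(p, q)) (V : 'M[R]_q) : Prop :=
  [/\ U^T *m U = 1%:M, V^T *m V = 1%:M,
      (forall (i : 'I_p) (j : 'I_q), val i <> val j -> S i j = 0),
      (forall (i1 i2 : 'I_p) (j1 j2 : 'I_q),
          val i1 = val j1 -> val i2 = val j2 -> (val i1 <= val i2)%N ->
          0 <= S i2 j2 <= S i1 j1)
    & G = U *m S *m V^T].

Definition param (R : realType) (NL : nat) (m n : 'I_NL -> nat) : Type :=
  forall l : 'I_NL, 'M[R]_(m l, n l).

Section ParamOps.
Context (R : realType) (NL : nat) (m n : 'I_NL -> nat).
Local Notation P := (param R m n).

Definition padd (x y : P) : P := fun l => x l + y l.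
Definition psub (x y : P) : P := fun l => x l - y l.
Definition pinner (x y : P) : R := \sum_(l < NL) frob_inner (x l) (y l).
Definition psqnorm (x : P) : R := pinner x x.
Definition pnorm (x : P) : R := Num.sqrt (psqnorm x).

Definition is_gradient (f : P -> R) (g : P -> P) : Prop :=
  forall (x : P) (e : R), 0 < e ->
    exists2 dl : R, 0 < dl & forall v : P, pnorm v < dl ->
      `| f (padd x v) - f x - pinner (g x) v | <= e * pnorm v.

Definition lipschitz_grad (g : P -> P) (L : R) : Prop :=
  forall x y : P, pnorm (psub (g x) (g y)) <= L * pnorm (psub x y).

Definition measurable_param (d' : measure_display) (T' : measurableType d')
    (y : T' -> P) : Prop :=
  forall l i j, measurable_fun setT (fun w => y w l i j).
End ParamOps.

Definition measurable_mx (R : realType) (p q : nat) (d' : measure_display)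
    (T' : measurableType d') (y : T' -> 'M[R]_(p, q)) : Prop :=
  forall i j, measurable_fun setT (fun w => y w i j).

Definition iid_family (R : realType) (dO dX : measure_display)
    (Omega : measurableType dO) (Xi : measurableType dX)
    (P : probability Omega R) (D : probability Xi R)
    (I : eqType) (xi : I -> Omega -> Xi) : Prop :=
  (forall i, measurable_fun setT (xi i)) /\
  forall (s : seq I) (A : I -> set Xi), uniq s -> (forall i, measurable (A i)) ->
    P (\bigcap_(i in [set` s]) (xi i @^-1` A i)) =
    ((\prod_(i <- s) fine (D (A i)))%:E)%E.

(* per-layer state after iteration t-1:
   X^{(t)}, P^{(t-1)}, Q^{(t-1)}, and the momentum M^{(t-1)} in both the
   (m <= n)-form  (r x n)  and the (m > n)-form  (m x r); only the form
   selected by the layer's shape influences X. *)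
Record lstate (R : Type) (p q r : nat) := LState {
  lX : 'M[R]_(p, q);
  lP : 'M[R]_(p, r);
  lQ : 'M[R]_(q, r);
  lML : 'M[R]_(r, q);
  lMR : 'M[R]_(p, r) }.

Definition lstep (R : realType) (p q r : nat) (beta eta : R) (refresh : bool)
    (G : 'M[R]_(p, q)) (Pn : 'M[R]_(p, r)) (Qn : 'M[R]_(q, r))
    (s : lstate R p q r) : lstate R p q r :=
  let Pt := if refresh then Pn else lP s in
  let Qt := if refresh then Qn else lQ s in
  let ML := (1 - beta) *: (Pt^T *m lP s *m lML s) + beta *: (Pt^T *m G) in
  let MR := (1 - beta) *: (lMR s *m (lQ s)^T *m Qt) + beta *: (G *m Qt) in
  let X := if (p <= q)%N then lX s - eta *: (Pt *m ML)
           else lX s - eta *: (MR *m Qt^T) in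
  LState X Pt Qt ML MR.

Section Galore.
Context (R : realType) (NL : nat) (m n r : 'I_NL -> nat).
Context (Xi : Type).

Definition gstate := forall l : 'I_NL, lstate R (m l) (n l) (r l).
Definition gX (s : gstate) : param R m n := fun l => lX (s l).

(* M^{(-1)} = 0 (P^{(-1)}, Q^{(-1)} are irrelevant and set to 0) *)
Definition ginit (x0 : param R m n) : gstate :=
  fun l => LState (x0 l) 0 0 0 0.

Definition stoch_grad (tau Bsz : nat) (gradF : param R m n -> Xi -> param R m n)
    (samples : nat -> nat -> Xi) (t : nat) (x : param R m n) : param R m n :=
  fun l => if (t %% tau == 0)%N
           then (Bsz%:R)^-1 *: \sum_(b < Bsz) gradF x (samples t b) l
           else gradF x (samples t 0%N) l.

Fixpoint galore_state (beta eta : R) (tau Bsz : nat)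
    (gradF : param R m n -> Xi -> param R m n)
    (svdP : nat -> forall l : 'I_NL, 'M[R]_(m l, n l) -> 'M[R]_(m l, r l))
    (svdQ : nat -> forall l : 'I_NL, 'M[R]_(m l, n l) -> 'M[R]_(n l, r l))
    (samples : nat -> nat -> Xi) (x0 : param R m n) (t : nat) : gstate :=
  match t with
  | 0%N => ginit x0
  | t'.+1 =>
      let s := galore_state beta eta tau Bsz gradF svdP svdQ samples x0 t' in
      let G := stoch_grad tau Bsz gradF samples t' (gX s) in
      fun l => lstep beta eta (t' %% tau == 0)%N (G l)
                 (svdP t' l (G l)) (svdQ t' l (G l)) (s l)
  end.

Definition galore_iter beta eta tau Bsz gradF svdP svdQ samples x0 t : param R m n :=
  gX (galore_state beta eta tau Bsz gradF svdP svdQ samples x0 t).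
End Galore.

(* Main.v *)
(** GaLore's lifted momentum obeys M~_t = Pi_t ((1 - beta) M~_(t-1) + beta G_t), where Pi_t is
    the orthogonal projection given by the current top singular vectors and
    x_(t+1) = x_t - eta M~_t.  The error M~_t - grad f(x_t) splits orthogonally into
    e_t = |Pi_t (M~_t - grad f(x_t))|^2 and h_t = |(1 - Pi_t) grad f(x_t)|^2.
    At a refresh the SVD gives |(1 - Pi) G|^2 <= (1 - delta) |G|^2, and by Lipschitz continuity
    and the large batch this persists during the whole period, so that the sum of the h_t is
    at most (1 - delta / 2) times the sum of the |grad f(x_t)|^2, up to noise and drift.
    The expected e_t contract by 1 - beta, except at a refresh, where the previous h is added;
    averaged over a period of length tau >= 64 / (3 delta beta) this costs only a small multiple
    of delta.  Hence the descent lemma keeps a fraction of delta of the squared gradients. *)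
Require Import Defs.
From HB Require Import structures.
From mathcomp Require Import all_boot all_order all_algebra.
From mathcomp Require Import all_classical all_reals all_analysis.
From mathcomp Require Import measurable_realfun.
From mathcomp Require Import ring lra.
Import Order.TTheory GRing.Theory Num.Theory.
Local Open Scope classical_set_scope.
Local Open Scope ring_scope.
Set Implicit Arguments. Unset Strict Implicit. Unset Printing Implicit Defensive.

(** The recursions are shaped by when the projection may be treated as fixed. Between refreshes Pi_t
    is a function of earlier samples, so it is kept while the fresh noise is averaged out, and the
    complement of the gradient never enters. At a refresh Pi_t is built from the very samples to
    which it is applied. It must then be dropped, as a contraction, before the noise can be used as
    mean zero; what remains is, up to drift, the whole previous gap between momentum and gradient,
    whose orthogonal part is the previous h. This loss is of the order of a full gradient and is
    affordable only because it occurs once per period.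

    Conditional expectation is replaced by Tonelli's theorem: the past is a coarser sigma-algebra on
    the same sample space, the fresh sample is independent of it and is integrated out with the past
    held fixed. Afterwards only inequalities between real sequences remain. The drift sums in them
    are absorbed by the quadratic term that a small step size leaves over in the descent lemma. *)

Section ParamSpace.
Context (R : realType) (NL : nat) (m n : 'I_NL -> nat).
Local Notation V := (param R m n).
Implicit Types (x y z : V) (a : R).

(** A parameter is a dependent family of matrices of varying sizes. The module structure gives
    access to generic sums and scalings, and [padd] and [psub] are its operations by conversion. *)
HB.instance Definition _ := gen_eqMixin V.
HB.instance Definition _ := gen_choiceMixin V.

Let paddA : associative (@padd R NL m n).
Proof. by move=> x y z; apply: functional_extensionality_dep => l; rewrite /padd addrA. Qed.
Let paddC : commutative (@padd R NL m n).
Proof. by move=> x y; apply: functional_extensionality_dep => l; rewrite /padd addrC. Qed.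
Let padd0 : left_id (fun l => 0 : 'M[R]_(m l, n l)) (@padd R NL m n).
Proof. by move=> x; apply: functional_extensionality_dep => l; rewrite /padd add0r. Qed.
Let paddN : left_inverse (fun l => 0 : 'M[R]_(m l, n l))
  (fun x : V => (fun l => - x l) : V) (@padd R NL m n).
Proof. by move=> x; apply: functional_extensionality_dep => l; rewrite /padd addNr. Qed.

HB.instance Definition _ := GRing.isZmodule.Build V paddA paddC padd0 paddN.

Definition pscale a x : V := fun l => a *: x l.

Let pscaleA a b x : pscale a (pscale b x) = pscale (a * b) x.
Proof. by apply: functional_extensionality_dep => l; rewrite /pscale scalerA. Qed.
Let pscale1 : left_id 1 pscale.
Proof. by move=> x; apply: functional_extensionality_dep => l; rewrite /pscale scale1r. Qed.
Let pscaleDr : right_distributive pscale +%R.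
Proof.
by move=> a x y; apply: functional_extensionality_dep => l; rewrite /pscale scalerDr.
Qed.
Let pscaleDl x : {morph pscale^~ x : a b / a + b}.
Proof.
by move=> a b; apply: functional_extensionality_dep => l; rewrite /pscale scalerDl.
Qed.

HB.instance Definition _ :=
  GRing.Zmodule_isLmodule.Build R V pscaleA pscale1 pscaleDr pscaleDl.

Lemma paddE x y : padd x y = x + y. Proof. by []. Qed.
Lemma psubE x y : psub x y = x - y. Proof. by []. Qed.

Lemma param_sumE (I : Type) (s : seq I) (P : pred I) (F : I -> V) (l : 'I_NL) :
  (\sum_(i <- s | P i) F i) l = \sum_(i <- s | P i) F i l.
Proof. by elim/big_rec2: _ => // i y1 y2 _ <-. Qed.
End ParamSpace.

(** * Inner products of matrices and of parameters *)

Section FrobInner.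
Context (R : realType).

Lemma frob_innerE (p q : nat) (A B : 'M[R]_(p, q)) : frob_inner A B = \tr (A *m B^T).
Proof.
apply: eq_bigr => i _; rewrite !mxE; apply: eq_bigr => j _; by rewrite !mxE.
Qed.

Lemma frob_innerC (p q : nat) (A B : 'M[R]_(p, q)) : frob_inner A B = frob_inner B A.
Proof. by rewrite !frob_innerE -mxtrace_tr trmx_mul trmxK. Qed.

Lemma frob_inner_tr (p q : nat) (A B : 'M[R]_(p, q)) :
  frob_inner A^T B^T = frob_inner A B.
Proof. by rewrite !frob_innerE trmxK mxtrace_mulC -frob_innerE frob_innerC frob_innerE. Qed.

Lemma frob_innerDl (p q : nat) (A B C : 'M[R]_(p, q)) :
  frob_inner (A + B) C = frob_inner A C + frob_inner B C.
Proof. by rewrite !frob_innerE mulmxDl mxtraceD. Qed.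

Lemma frob_innerZl (p q : nat) a (A C : 'M[R]_(p, q)) :
  frob_inner (a *: A) C = a * frob_inner A C.
Proof. by rewrite !frob_innerE -scalemxAl mxtraceZ. Qed.

Lemma frob_inner_mull (p q k : nat) (W : 'M[R]_(p, k)) (A : 'M[R]_(k, q)) (B : 'M[R]_(p, q)) :
  frob_inner (W *m A) B = frob_inner A (W^T *m B).
Proof.
by rewrite !frob_innerE trmx_mul trmxK [RHS]mxtrace_mulC mxtrace_mulC !mulmxA
  mxtrace_mulC -mulmxA mxtrace_mulC.
Qed.

Lemma frob_inner_mulr (p q k : nat) (W : 'M[R]_(k, q)) (A : 'M[R]_(p, k)) (B : 'M[R]_(p, q)) :
  frob_inner (A *m W) B = frob_inner A (B *m W^T).
Proof. by rewrite !frob_innerE trmx_mul trmxK mulmxA. Qed.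

Lemma frob_sq_ge0 (p q : nat) (A : 'M[R]_(p, q)) : 0 <= frob_sq A.
Proof. by apply: sumr_ge0 => i _; apply: sumr_ge0 => j _; rewrite -expr2 sqr_ge0. Qed.
End FrobInner.

Section ParamInner.
Context (R : realType) (NL : nat) (m n : 'I_NL -> nat).
Local Notation V := (param R m n).
Implicit Types (x y z : V) (a : R).

Lemma pinnerC x y : pinner x y = pinner y x.
Proof. by apply: eq_bigr => l _; rewrite frob_innerC. Qed.

Lemma pinnerDl x y z : pinner (x + y) z = pinner x z + pinner y z.
Proof. by rewrite -big_split /=; apply: eq_bigr => l _; rewrite -frob_innerDl. Qed.

Lemma pinnerZl a x z : pinner (a *: x) z = a * pinner x z.
Proof. by rewrite /pinner mulr_sumr; apply: eq_bigr => l _; rewrite -frob_innerZl. Qed.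

Lemma pinnerNl x z : pinner (- x) z = - pinner x z.
Proof. by rewrite -scaleN1r pinnerZl mulN1r. Qed.

Lemma pinnerDr z x y : pinner z (x + y) = pinner z x + pinner z y.
Proof. by rewrite !(pinnerC z) pinnerDl. Qed.

Lemma pinnerZr a x z : pinner z (a *: x) = a * pinner z x.
Proof. by rewrite !(pinnerC z) pinnerZl. Qed.

Lemma pinnerNr x z : pinner z (- x) = - pinner z x.
Proof. by rewrite !(pinnerC z) pinnerNl. Qed.

Definition pinnerE := (pinnerDl, pinnerDr, pinnerZl, pinnerZr, pinnerNl, pinnerNr).

Lemma psqnorm_ge0 x : 0 <= psqnorm x.
Proof. by apply: sumr_ge0 => l _; exact: frob_sq_ge0. Qed.

Lemma pnorm_ge0 x : 0 <= pnorm x. Proof. exact: sqrtr_ge0. Qed.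

Lemma sqr_pnorm x : pnorm x ^+ 2 = psqnorm x.
Proof. by rewrite sqr_sqrtr// psqnorm_ge0. Qed.

Lemma psqnorm0 : psqnorm (0 : V) = 0.
Proof. by rewrite /psqnorm -(scale0r (0 : V)) pinnerZl mul0r. Qed.

Lemma psqnormZ a x : psqnorm (a *: x) = a ^+ 2 * psqnorm x.
Proof. by rewrite /psqnorm !pinnerE mulrA. Qed.

Lemma psqnormN x : psqnorm (- x) = psqnorm x.
Proof. by rewrite /psqnorm !pinnerE opprK. Qed.

Lemma pnormZ a x : pnorm (a *: x) = `|a| * pnorm x.
Proof. by rewrite /pnorm psqnormZ sqrtrM ?sqr_ge0// sqrtr_sqr. Qed.

Lemma psqnormD x y : psqnorm (x + y) = psqnorm x + 2 * pinner x y + psqnorm y.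
Proof. rewrite /psqnorm !pinnerE (pinnerC y x); ring. Qed.

Lemma psqnormB x y : psqnorm (x - y) = psqnorm x - 2 * pinner x y + psqnorm y.
Proof. by rewrite psqnormD psqnormN pinnerNr mulrN. Qed.

(** In the induction, Young's inequality with weight [size s] on the cross term makes the constant
    grow by exactly one. An empty tail is treated apart, since the argument divides by its size. *)
Lemma psqnorm_sum_le (I : Type) (s : seq I) (F : I -> V) :
  psqnorm (\sum_(i <- s) F i) <= (size s)%:R * \sum_(i <- s) psqnorm (F i).
Proof.
elim: s => [|i s IH]; first by rewrite !big_nil psqnorm0 mul0r.
rewrite !big_cons psqnormD /= -natr1.
set S := \sum_(j <- s) F j; set N := \sum_(j <- s) psqnorm (F j).
have N0 : 0 <= N by apply: sumr_ge0 => j _; exact: psqnorm_ge0.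
have cross : 2 * pinner (F i) S <= (size s)%:R * psqnorm (F i) + N.
  have [/eqP/size0nil s0|s0] := boolP (size s == 0)%N.
    by rewrite /S /N s0 !big_nil -(scale0r (0 : V)) pinnerZr mul0r mulr0 addr0 mul0r.
  have k0 : 0 < (size s)%:R :> R by rewrite ltr0n lt0n.
  have := psqnorm_ge0 ((size s)%:R *: F i - S).
  rewrite psqnormB psqnormZ pinnerZl => H.
  have H2 : 2 * ((size s)%:R * pinner (F i) S) <=
    (size s)%:R * ((size s)%:R * psqnorm (F i) + N).
    by rewrite -/S -/N in IH; lra.
  by rewrite -(ler_pM2l k0); apply: le_trans H2; rewrite mulrCA.
by rewrite -/S -/N in IH; lra.
Qed.

Lemma young_norm (c : R) x y : 0 < c ->
  psqnorm (x + y) <= (1 + c) * psqnorm x + (1 + c^-1) * psqnorm y.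
Proof.
move=> c0; have := psqnorm_ge0 (c *: x - y).
rewrite psqnormB psqnormZ pinnerZl psqnormD => H.
have : c^-1 * (2 * (c * pinner x y)) <= c^-1 * (c ^+ 2 * psqnorm x + psqnorm y).
  by rewrite ler_pM2l ?invr_gt0//; lra.
rewrite mulrDr expr2 -!mulrA !(mulrCA 2) mulKf ?gt_eqF// mulKf ?gt_eqF//; lra.
Qed.

Lemma psqnormD_le x y : psqnorm (x + y) <= 2 * psqnorm x + 2 * psqnorm y.
Proof. by have := young_norm x y ltr01; rewrite invr1. Qed.

Lemma cauchy_schwarz x y : pinner x y <= pnorm x * pnorm y.
Proof.
have [x0|x0] := eqVneq (psqnorm x) 0.
  rewrite /pnorm x0 sqrtr0 mul0r leNgt; apply/negP => p0.
  (* With [x] of norm zero, this multiple would give a square norm equal to -1. *)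
  have := psqnorm_ge0 (((psqnorm y + 1) / (2 * pinner x y)) *: x - y).
  rewrite psqnormB psqnormZ pinnerZl x0 mulr0 add0r.
  have -> : 2 * ((psqnorm y + 1) / (2 * pinner x y) * pinner x y) = psqnorm y + 1.
    by field; rewrite gt_eqF.
  lra.
have xp : 0 < psqnorm x by rewrite lt_def x0 psqnorm_ge0.
apply: (le_trans (ler_norm _)).
rewrite -sqrtr_sqr -sqrtrM ?psqnorm_ge0// ler_sqrt ?mulr_ge0 ?psqnorm_ge0//.
have := psqnorm_ge0 (pinner x y *: x - psqnorm x *: y).
rewrite psqnormB !psqnormZ !pinnerE => H.
rewrite -(ler_pM2l xp) expr2.
by move: H; rewrite !expr2; lra.
Qed.
End ParamInner.

(** * Truncated singular value decompositions *)

Section SvdProjection.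
Context (R : realType).

(** As a product with [pid_mx], truncation becomes accessible to matrix algebra. *)
Lemma firstcolsE (p k r : nat) (U : 'M[R]_(p, k)) : firstcols r U = U *m pid_mx r.
Proof.
apply/matrixP => i j; rewrite !mxE big_mkcond; apply: eq_bigr => c _.
rewrite mxE; have [-> | _] := eqVneq (val c) (val j); first by rewrite ltn_ord mulr1.
by rewrite mulr0.
Qed.

Lemma firstcols_orth (p r : nat) (U : 'M[R]_p) : (r <= p)%N -> U^T *m U = 1%:M ->
  (firstcols r U)^T *m firstcols r U = 1%:M.
Proof.
move=> rp UU; rewrite firstcolsE trmx_mul tr_pid_mx mulmxA -(mulmxA _ U^T) UU mulmx1.
by rewrite pid_mx_id// pid_mx_1.
Qed.

Lemma frob_sq_orth (p q : nat) (U : 'M[R]_p) (V : 'M[R]_q) (A : 'M[R]_(p, q)) :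
  U^T *m U = 1%:M -> V^T *m V = 1%:M -> frob_sq (U *m A *m V^T) = frob_sq A.
Proof.
move=> UU VV; rewrite /frob_sq -mulmxA frob_inner_mull !mulmxA UU mul1mx.
by rewrite frob_inner_mulr trmxK -mulmxA VV mulmx1.
Qed.

(** Every tail value is at most every head value. Summing this over all pairs gives [r] times the
    tail at most [p - r] times the head, which is the claim after clearing denominators. *)
Lemma sum_tail_le (p r : nat) (a : 'I_p -> R) : (0 < p)%N -> (r <= p)%N ->
  (forall i j : 'I_p, (i <= j)%N -> a j <= a i) ->
  \sum_(i < p | (r <= i)%N) a i <= (1 - r%:R / p%:R) * \sum_(i < p) a i.
Proof.
move=> p0 rp; have [k pE] : exists k, p = (r + k)%N by exists (p - r)%N; rewrite subnKC.
subst p => amono.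
have E : \sum_(i < r + k | (r <= i)%N) a i = \sum_(j < k) a (rshift r j).
  rewrite big_mkcond big_split_ord /= big1 ?add0r => [|i _].
    by apply: eq_bigr => j _; rewrite leq_addr.
  by rewrite leqNgt ltn_ord.
have H : r%:R * \sum_(j < k) a (rshift r j) <= k%:R * \sum_(i < r) a (lshift k i).
  rewrite !mulr_natl -[X in _ *+ X <= _]card_ord -[X in _ <= _ *+ X]card_ord -!sumr_const.
  rewrite exchange_big /=; apply: ler_sum => j _; apply: ler_sum => i _.
  by apply: amono; rewrite /= (leq_trans (ltnW (ltn_ord i)))// leq_addr.
have pR0 : 0 < (r + k)%:R :> R by rewrite ltr0n.
rewrite -(ler_pM2l pR0) mulrA mulrBr mulr1 mulrCA divff ?gt_eqF// mulr1 E big_split_ord /=.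
by rewrite natrD; lra.
Qed.

(** In the singular bases the residual is [S] with its first [r] rows erased, and the orthogonal
    factors preserve the norm. What is left is the tail of the squared singular values, which are
    nonincreasing. *)
Lemma svd_firstcols_le (p q r : nat) (G S : 'M[R]_(p, q)) (U : 'M[R]_p) (V : 'M[R]_q) :
  (0 < p <= q)%N -> (r <= p)%N -> is_svd G U S V ->
  frob_sq (G - firstcols r U *m (firstcols r U)^T *m G)
    <= (1 - r%:R / p%:R) * frob_sq G.
Proof.
move=> /andP[p0 pq] rp [UU VV Sdiag Smono GE].
have -> : G - firstcols r U *m (firstcols r U)^T *m G
    = U *m (S - pid_mx r *m S) *m V^T.
  rewrite firstcolsE GE mulmxBr mulmxBl; congr (_ - _).
  rewrite trmx_mul tr_pid_mx !mulmxA -(mulmxA _ U^T) UU mulmx1.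
  by rewrite -(mulmxA U (pid_mx r)) pid_mx_id// !mulmxA.
rewrite GE !frob_sq_orth//.
pose a (i : 'I_p) := \sum_(j < q) S i j * S i j.
have -> : frob_sq (S - pid_mx r *m S) = \sum_(i < p | (r <= i)%N) a i.
  rewrite [RHS]big_mkcond; apply: eq_bigr => i _.
  have D j : (S - pid_mx r *m S) i j = if (r <= i)%N then S i j else 0.
    rewrite !mxE (bigD1 i)//= !mxE eqxx /= big1 => [|k ki]; last first.
      have /negbTE ik : (i != k :> nat)%N by rewrite eq_sym.
      by rewrite mxE ik mul0r.
    by rewrite addr0; case: leqP; rewrite ?mul0r ?mul1r ?subr0 ?subrr.
  under eq_bigr do rewrite !D.
  by case: ifP => // _; rewrite big1// => j _; rewrite mul0r.
apply: sum_tail_le => // i j ij.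
have aE k : a k = S k (widen_ord pq k) ^+ 2.
  rewrite /a (bigD1 (widen_ord pq k))//= big1 ?addr0 -?expr2// => c ck.
  by rewrite Sdiag ?mul0r// => kc; move/eqP: ck; apply; exact: val_inj.
have /andP[s0 s1] := Smono i j (widen_ord pq i) (widen_ord pq j) erefl erefl ij.
by rewrite !aE ler_sqr ?nnegrE// (le_trans s0).
Qed.

(** Reduces tall layers to wide ones, the two singular bases exchanging roles. *)
Lemma is_svd_tr (p q : nat) (G S : 'M[R]_(p, q)) (U : 'M[R]_p) (V : 'M[R]_q) :
  is_svd G U S V -> is_svd G^T V S^T U.
Proof.
move=> [UU VV Sdiag Smono GE]; split => //.
- by move=> i j ij; rewrite mxE Sdiag// => /esym.
- by move=> i1 i2 j1 j2 e1 e2 le12; rewrite !mxE; apply: Smono; rewrite -?e1 -?e2.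
- by rewrite GE !trmx_mul trmxK mulmxA.
Qed.
End SvdProjection.

(** * Orthogonal projections of the parameter space *)

Section OrthoProjection.
Context (R : realType).

Definition lproj (p q r : nat) (P : 'M[R]_(p, r)) (Q : 'M[R]_(q, r)) (A : 'M[R]_(p, q)) :
  'M[R]_(p, q) := if (p <= q)%N then P *m P^T *m A else A *m Q *m Q^T.

Lemma svd_lproj_le (p q r : nat) (G S : 'M[R]_(p, q)) (U : 'M[R]_p) (V : 'M[R]_q) :
  (0 < r < minn p q)%N -> is_svd G U S V ->
  frob_sq (G - lproj (firstcols r U) (firstcols r V) G)
    <= (1 - r%:R / (minn p q)%:R) * frob_sq G.
Proof.
move=> /andP[r0 rpq] svdG.
have p0 : (0 < minn p q)%N by apply: leq_trans rpq.
rewrite /lproj; case: (leqP p q) rpq p0 => pq rp p0.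

  by apply: (svd_firstcols_le _ _ svdG); [rewrite p0 pq|exact: ltnW].
rewrite /frob_sq -frob_inner_tr -(frob_inner_tr G) linearB /= trmx_mul trmxK trmx_mul mulmxA.
by apply: (svd_firstcols_le _ _ (is_svd_tr svdG)); [rewrite p0 ltnW|exact: ltnW].
Qed.

Context (NL : nat) (m n : 'I_NL -> nat).
Local Notation V := (param R m n).

(** Stated abstractly to forget the layer shapes; the identity qualifies too, which lets one noise
    estimate serve with and without a projection. *)
Definition orthoproj (Pi : V -> V) : Prop :=
  [/\ (forall a x y, Pi (a *: x + y) = a *: Pi x + Pi y),
      (forall x y, pinner (Pi x) y = pinner x (Pi y)) &
      (forall x, Pi (Pi x) = Pi x)].

Section Theory.
Context (Pi : V -> V).
Hypothesis oPi : orthoproj Pi.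

Lemma orthoproj_lin a x y : Pi (a *: x + y) = a *: Pi x + Pi y.
Proof. by case: oPi. Qed.

Lemma orthoprojD x y : Pi (x + y) = Pi x + Pi y.
Proof. by rewrite -[x]scale1r orthoproj_lin !scale1r. Qed.

Lemma orthoproj0 : Pi 0 = 0.
Proof. by have := orthoproj_lin (-1) 0 0; rewrite scaler0 addr0 scaleN1r addNr. Qed.

Lemma orthoprojZ a x : Pi (a *: x) = a *: Pi x.
Proof. by rewrite -[X in Pi X]addr0 orthoproj_lin orthoproj0 addr0. Qed.

Lemma orthoprojB x y : Pi (x - y) = Pi x - Pi y.
Proof. by rewrite orthoprojD -[- y]scaleN1r orthoprojZ scaleN1r. Qed.

(** The difference [x - y] consists of a vector in the range of [Pi] and one in its kernel. It is
    applied with the momentum as [x] and the gradient as [y]. *)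
Lemma orthoproj_split x y : Pi x = x ->
  psqnorm (x - y) = psqnorm (Pi (x - y)) + psqnorm (y - Pi y).
Proof.
move=> Pix; case: oPi => _ sym idem.
have E : x - y = Pi (x - y) - (y - Pi y).
  by rewrite orthoprojB Pix opprB addrA addrNK.
have Pi0 : Pi (y - Pi y) = 0 by rewrite orthoprojB idem subrr.
rewrite {1}E psqnormB sym Pi0.
by rewrite -(scale0r (0 : V)) pinnerZr mul0r mulr0 subr0.
Qed.

Lemma orthoproj_pythagoras y : psqnorm y = psqnorm (Pi y) + psqnorm (y - Pi y).
Proof.
have := orthoproj_split y orthoproj0.
by rewrite sub0r psqnormN -scaleN1r orthoprojZ scaleN1r psqnormN.
Qed.

Lemma orthoproj_le y : psqnorm (Pi y) <= psqnorm y.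
Proof. by rewrite [leRHS]orthoproj_pythagoras lerDl psqnorm_ge0. Qed.

Lemma orthoproj_compl_le y : psqnorm (y - Pi y) <= psqnorm y.
Proof. by rewrite [leRHS]orthoproj_pythagoras lerDr psqnorm_ge0. Qed.

(* Two applications of Young's inequality, with weight [dl / 4]. *)
Lemma orthoproj_compl_transfer (dl : R) (G g : V) : 0 < dl <= 1 ->
  psqnorm (G - Pi G) <= (1 - dl) * psqnorm G ->
  psqnorm (g - Pi g) <= (1 - dl / 2) * psqnorm g + 10 / dl * psqnorm (g - G).
Proof.
move=> /andP[dl0 dl1] H.
have c0 : 0 < dl / 4 by rewrite divr_gt0.
have H1 : psqnorm (g - Pi g) <= (1 + dl / 4) * psqnorm (G - Pi G)
    + (1 + (dl / 4)^-1) * psqnorm (g - G).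
  have -> : g - Pi g = (G - Pi G) + ((g - G) - Pi (g - G)).
    by rewrite orthoprojB opprB addrACA [G + _]addrC subrK addKr.
  apply: (le_trans (young_norm _ _ c0)); rewrite lerD2l ler_wpM2l ?orthoproj_compl_le//.
  by rewrite addr_ge0// invr_ge0 ltW.
have H2 : psqnorm G <= (1 + dl / 4) * psqnorm g + (1 + (dl / 4)^-1) * psqnorm (g - G).
  have E : G = g + (- (g - G)) by rewrite opprB addrC subrK.
  by rewrite {1}E -[X in _ <= _ + _ * X]psqnormN; exact: young_norm.
have iE : (dl / 4)^-1 = 4 / dl by rewrite invf_div.
have i1 : 1 <= dl^-1 by rewrite invr_ge1// ?unitfE ?gt_eqF.
rewrite iE in H1 H2.
have g0 := psqnorm_ge0 g; have d0 := psqnorm_ge0 (g - G).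
set a := psqnorm g in g0 H1 H2 *; set b := psqnorm (g - G) in d0 H1 H2 *.
set i := dl^-1 in i1 H1 H2 *.
have H3 : psqnorm (G - Pi G) <= (1 - dl) * ((1 + dl / 4) * a + (1 + 4 * i) * b).
  by apply: (le_trans H); rewrite ler_wpM2l// subr_ge0.
have H4 : psqnorm (g - Pi g) <=
    (1 + dl / 4) * ((1 - dl) * ((1 + dl / 4) * a + (1 + 4 * i) * b)) + (1 + 4 * i) * b.
  by apply: (le_trans H1); rewrite lerD2r ler_wpM2l// addr_ge0// ltW.
apply: (le_trans H4).
have k1 : (1 + dl / 4) * (1 - dl) * (1 + dl / 4) <= 1 - dl / 2.
  have : 0 <= dl * dl * dl by rewrite !mulr_ge0// ltW.
  have : 0 <= dl * dl by rewrite mulr_ge0// ltW.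
  by lra.
have k2 : (1 + dl / 4) * (1 - dl) <= 1.
  have : 0 <= dl * dl by rewrite mulr_ge0// ltW.
  by lra.
have b1 : (1 + dl / 4) * (1 - dl) * ((1 + 4 * i) * b) <= (1 + 4 * i) * b.
  by rewrite ler_piMl// mulr_ge0//; lra.
have b2 : (1 + dl / 4) * (1 - dl) * (1 + dl / 4) * a <= (1 - dl / 2) * a.
  by rewrite ler_wpM2r.
(* The terms in [b] add up to at most 2 + 8 / dl, hence to at most 10 / dl. *)
have b3 : b <= i * b by rewrite ler_peMl.
by lra.
Qed.
End Theory.
End OrthoProjection.

(** * Smoothness and the descent lemma *)

Section Descent.
Context (R : realType) (NL : nat) (m n : 'I_NL -> nat).
Local Notation V := (param R m n).
Import numFieldNormedType.Exports.
Context (f : V -> R) (g : V -> V) (L : R).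
Hypotheses (fg : is_gradient f g) (gL : lipschitz_grad g L) (L0 : 0 < L).

(** Restricting to a line leaves only one-dimensional calculus for the descent lemma. *)
Lemma gradient_is_derive_line (x v : V) (s : R) :
  is_derive s (1 : R) (fun s : R => f (x + s *: v) : R) (pinner (g (x + s *: v)) v).
Proof.
set D := pinner _ _; set phi := fun s : R => _.
suff H : h^-1 *: ((phi \o shift s) (h *: (1 : R)) - phi s) @[h --> 0^'] --> (D : R).
  by apply: DeriveDef; [exact: cvgP H|exact: cvg_lim H].
apply/cvgrPdist_le => e e0.
(* The added 1 allows the division also when [v] is zero. *)
have N0 : 0 < pnorm v + 1 by rewrite ltr_wpDl ?pnorm_ge0.
have [dl dl0 Hdl] := fg (x + s *: v) (divr_gt0 e0 N0).
near=> h.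
have h0 : h != 0 by near: h; exact: nbhs_dnbhs_neq.
have hd : `|h| * (pnorm v + 1) < dl.
  rewrite -ltr_pdivlMr//; near: h; apply: dnbhs0_lt; exact: divr_gt0.
have hv : pnorm (h *: v) < dl.
  by rewrite pnormZ; apply: le_lt_trans hd; rewrite ler_wpM2l// lerDl.
have := Hdl _ hv; rewrite paddE pinnerZr -/D pnormZ => H.
have -> : (phi \o shift s) (h *: (1 : R)) - phi s
    = f (x + s *: v + h *: v) - f (x + s *: v).
  by rewrite /phi /= [h *: 1]mulr1 scalerDl [h *: v + _]addrC addrA.
have hp : 0 < `|h| by rewrite normr_gt0.
rewrite -(ler_pM2l hp) -normrM mulrBr mulrA mulfV// mul1r distrC.
apply: (le_trans H); rewrite mulrCA ler_wpM2l// mulrAC ler_pdivrMr// ler_pM2l//.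
by rewrite lerDl.
Unshelve. all: by end_near.
Qed.

(** [psi] is [f] on the segment minus the nonconstant part of its quadratic upper model. By the
    Lipschitz bound its derivative is nonpositive at the point given by the mean value theorem, so
    no integral of the gradient is needed. *)
Lemma descent_lemma (x v : V) :
  f (x + v) <= f x + pinner (g x) v + L / 2 * psqnorm v.
Proof.
pose psi (s : R) : R := f (x + s *: v) - (s * pinner (g x) v + s ^+ 2 * (L / 2 * psqnorm v)).
pose dpsi (s : R) : R := pinner (g (x + s *: v)) v - (pinner (g x) v + s * (L * psqnorm v)).
have dpsiP (s : R) : is_derive s (1 : R) psi (dpsi s).
  have H := gradient_is_derive_line x v s.
  apply: is_derive_eq; rewrite /dpsi.
  by rewrite !scaler0 !add0r /GRing.scale /=; lra.
have [c /andP[c0 c1] E] : exists2 c, c \in `[0, 1]%R & psi 1 - psi 0 = dpsi c * (1 - 0).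
  apply: (MVT_segment ler01).
  apply: continuous_subspaceT => z; apply: differentiable_continuous.
  by apply/derivable1_diffP; exact: ex_derive.
have le0 : dpsi c <= 0.
  rewrite /dpsi; have := cauchy_schwarz (g (x + c *: v) - g x) v.
  have := gL (x + c *: v) x; rewrite !psubE addrAC subrr add0r pnormZ ger0_norm// => H1 H2.
  have H3 := ler_wpM2r (pnorm_ge0 v) H1.
  have := le_trans H2 H3; rewrite -!mulrA -expr2 sqr_pnorm pinnerDl pinnerNl; lra.
move: E; rewrite /psi scale1r scale0r addr0; lra.
Qed.

(** A gradient step of size [L^-1] cannot go below [b]. This controls the initial error: the
    momentum starts at zero, so the initial gap is the gradient at [x0]. *)
Lemma psqnorm_gradient_le (b : R) (x : V) : (forall y, b <= f y) ->
  psqnorm (g x) <= 2 * L * (f x - b).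
Proof.
move=> bf; have := descent_lemma x (- (L^-1 *: g x)).
have := bf (x - L^-1 *: g x).
rewrite psqnormN psqnormZ pinnerNr pinnerZr -/(psqnorm (g x)) => H1 H2.
have H := le_trans H1 H2.
have Lne : L != 0 by rewrite gt_eqF.
have E : L / 2 * (L^-1 ^+ 2 * psqnorm (g x)) = L^-1 * psqnorm (g x) / 2 by field.
rewrite E in H.
have : L^-1 * psqnorm (g x) <= 2 * (f x - b) by lra.
by rewrite mulrC ler_pdivrMr// mulrAC.
Qed.
End Descent.

(** * Independence of a fresh sample from the past *)

Section Independence.
Context (R : realType) (dO dX : measure_display) (Omega : measurableType dO)
  (Xi : measurableType dX) (P : probability Omega R) (D : probability Xi R)
  (J : eqType) (xi : J -> Omega -> Xi).
Hypothesis iid : iid_family P D xi.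

(** A pi-system generating the sigma-algebra of the samples with index in [S]; finite lists of
    indices match the form of [iid_family]. *)
Definition cylinders (S : pred J) : set (set Omega) :=
  [set X | exists (s : seq J) (A : J -> set Xi), [/\ {subset s <= S}, (forall i, measurable (A i)) &
    X = \bigcap_(i in [set` s]) (xi i @^-1` A i)]].

Lemma iid_measurable i : measurable_fun setT (xi i).
Proof. by case: iid. Qed.

Lemma cylinders_measurable S : cylinders S `<=` measurable.
Proof.
move=> _ [s [A [_ mA ->]]]; apply: fin_bigcap_measurable => // i _.
by rewrite -[_ @^-1` _]setTI; exact: iid_measurable.
Qed.

Lemma cylinders_setI S : setI_closed (cylinders S).
Proof.
move=> _ _ [s [A [sS mA ->]]] [s' [A' [sS' mA' ->]]].
exists (s ++ s'), (fun i => (if i \in s then A i else setT) `&`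
  (if i \in s' then A' i else setT)); split.
- by move=> i; rewrite mem_cat => /orP[/sS|/sS'].
- by move=> i; apply: measurableI; case: ifP.
- apply/seteqP; split => [w [H H'] i _ /=|w H].
    by split; case: ifPn => // si; [exact: H|exact: H'].
  split=> i /= si.
    by have := H i; rewrite /= mem_cat si /= => /(_ isT)[].
  by have := H i; rewrite /= mem_cat si orbT /= => /(_ isT)[].
Qed.

Lemma cylinders_setT S : cylinders S setT.
Proof. by exists [::], (fun=> setT); split => //; rewrite set_nil bigcap_set0. Qed.

Lemma cylinders_indep (S : pred J) j (X : set Omega) (B : set Xi) :
  j \notin S -> cylinders S X -> measurable B ->
  P (X `&` xi j @^-1` B) = (P X * D B)%E.
Proof.
move=> jS [s [A [sS mA ->]]] mB; case: iid => _ iidP.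
have js : j \notin undup s by rewrite mem_undup; apply: contra jS => /sS.
(* The event at [j] joins the cylinder as one more coordinate. Repetitions are removed from the list
   because [iid_family] asks for distinct indices. *)
pose A' i := if i == j then B else A i.
have mA' i : measurable (A' i) by rewrite /A'; case: ifP.
have eqs : [set` undup s] = [set` s] by apply/seteqP; split=> i /=; rewrite mem_undup.
have := iidP (j :: undup s) A'; rewrite cons_uniq js undup_uniq /= => /(_ isT mA').
have -> : \bigcap_(i in [set` j :: undup s]) xi i @^-1` A' i =
    \bigcap_(i in [set` s]) xi i @^-1` A i `&` xi j @^-1` B.
  apply/seteqP; split => [w H|w [H Hj] i /=].
    split => [i /= si|].
      have := H i; rewrite /= inE mem_undup si orbT => /(_ isT); rewrite /A'.
      by case: eqP => // ij; move: js; rewrite mem_undup -ij si.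
    by have := H j; rewrite /= mem_head => /(_ isT); rewrite /A' eqxx.
  rewrite inE mem_undup => /orP[/eqP->|si]; rewrite /A' ?eqxx//.
  by case: eqP => [->|_]; [exact: Hj|exact: H].
move=> ->; have := iidP (undup s) A (undup_uniq s) mA; rewrite eqs => ->.
rewrite big_cons /A' eqxx mulrC EFinM fineK ?fin_num_measure//; congr (_%:E * _)%E.
rewrite big_seq [RHS]big_seq; apply: eq_bigr => i si; case: eqP => // ij.
by move: js; rewrite -ij si.
Qed.

(** As functions of [X] both sides are finite measures, a restriction and a multiple of [P]. They
    agree on the cylinders, hence on the generated sigma-algebra. *)
Lemma sigma_cylinders_indep (S : pred J) j (X : set Omega) (B : set Xi) :
  j \notin S -> <<s cylinders S >> X -> measurable B ->
  P (X `&` xi j @^-1` B) = (P X * D B)%E.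
Proof.
move=> jS SX mB.
have mB' : measurable (xi j @^-1` B).
  by rewrite -[_ @^-1` _]setTI; exact: iid_measurable.
have DB : D B \is a fin_num by exact: fin_num_measure.
have DB0 : 0 <= fine (D B) by rewrite fine_ge0.
have coverT : \bigcup_(k : nat) (fun=> setT : set Omega) k = setT.
  by apply/seteqP; split=> // w _; exists 0%N.
transitivity (mscale (NngNum DB0) P X); last by rewrite /mscale /= fineK// muleC.
apply: (@g_sigma_algebra_measure_unique _ R Omega (cylinders S) (@cylinders_measurable S)
  (fun=> setT) (fun=> cylinders_setT S) coverT (mrestr P mB') (mscale (NngNum DB0) P)
  (@cylinders_setI S)) => //= [A SA|_].
  by rewrite /mrestr /mscale /= fineK// muleC; exact: cylinders_indep SA mB.
by rewrite /mrestr setTI -ge0_fin_numE// fin_num_measure.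
Qed.

(** The points of [Omega] with a coarser sigma-algebra, so that depending on the past only is
    ordinary measurability on this type. *)
Definition sigma_past (S : pred J) : measurableType _ := g_sigma_algebraType (cylinders S).

Lemma sigma_past_le S (X : set Omega) : <<s cylinders S >> X -> measurable X.
Proof.
by apply: smallest_sub; [exact: sigma_algebra_measurable|exact: cylinders_measurable].
Qed.

Lemma measurable_sigma_past (S : pred J) i : i \in S ->
  measurable_fun setT (xi i : sigma_past S -> Xi).
Proof.
move=> iS _ B mB; rewrite setTI; apply: sub_sigma_algebra.
exists [:: i], (fun=> B); split => //; first by move=> k; rewrite inE => /eqP ->.
by rewrite set_cons1 bigcap_set1.
Qed.

Lemma measurable_fun_sigma_past (S : pred J) (d : measure_display) (T : measurableType d)
    (f : sigma_past S -> T) : measurable_fun setT f -> measurable_fun setT (f : Omega -> T).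
Proof.
by move=> mf _ B mB; apply: (@sigma_past_le S); exact: (mf measurableT B mB).
Qed.

(** The joint law of [Y] and the sample agrees with a product measure on rectangles, hence equals
    it, and Tonelli's theorem applies. *)
Lemma integral_indep_pair (d1 : measure_display) (T1 : measurableType d1) (Y : Omega -> T1)
    (j : J) (phi : T1 * Xi -> \bar R) :
  measurable_fun setT Y ->
  (forall A B, measurable A -> measurable B ->
    P (Y @^-1` A `&` xi j @^-1` B) = (P (Y @^-1` A) * D B)%E) ->
  measurable_fun setT phi -> (forall u, 0 <= phi u)%E ->
  (\int[P]_w phi (Y w, xi j w) = \int[P]_w \int[D]_z phi (Y w, z))%E.
Proof.
move=> mY indep mphi phi0.
have mpair : measurable_fun setT (fun w => (Y w, xi j w)).
  exact: (measurable_fun_pair mY (iid_measurable j)).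
pose X1 : {mfun Omega >-> T1} := HB.pack Y (isMeasurableFun.Build _ _ _ _ _ mY).
pose X2 : {mfun Omega >-> (T1 * Xi)%type} :=
  HB.pack (fun w => (Y w, xi j w)) (isMeasurableFun.Build _ _ _ _ _ mpair).
have E X : measurable X -> (distribution P X1 \x D)%E X = distribution P X2 X.
  by apply: product_measure_unique => A B mA mB; exact: indep.
transitivity (\int[distribution P X2]_u phi u)%E.
  by rewrite ge0_integral_distribution.
rewrite (eq_measure_integral (distribution P X1 \x D)%E); last by move=> A mA _; exact/esym/E.
rewrite fubini_tonelli1// ge0_integral_distribution//; first exact: measurable_fun_fubini_tonelli_F.
by move=> w; exact: integral_ge0.
Qed.

(* Conditioning on the past: a sample outside the past may be integrated out first. *)
Lemma integral_indep (S : pred J) (j : J) (phi : sigma_past S * Xi -> \bar R) :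
  j \notin S -> measurable_fun setT phi -> (forall u, 0 <= phi u)%E ->
  (\int[P]_w phi (w, xi j w) = \int[P]_w \int[D]_z phi (w, z))%E.
Proof.
move=> jS mphi phi0.
(* Taking for [Y] the identity into the coarser space lets [phi] depend on the whole past. *)
apply: (@integral_indep_pair _ (sigma_past S) (idfun : Omega -> sigma_past S)) => //.
  by move=> _ B mB; rewrite setTI; exact: (@sigma_past_le S).
by move=> A B mA mB; exact: (sigma_cylinders_indep jS mA mB).
Qed.
End Independence.

(** * Expectations as real numbers *)

Section RealExpectation.
Context (R : realType) (d : measure_display) (T : measurableType d) (P : probability T R).
Implicit Types phi psi : T -> R.

Definition rintegrable phi : Prop := P.-integrable setT (EFin \o phi).

Lemma rintegrable_measurable phi : rintegrable phi -> measurable_fun setT phi.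
Proof. by move=> /integrableP[/measurable_EFinP]. Qed.

Lemma rintegrable_le phi psi : measurable_fun setT phi -> (forall w, 0 <= phi w <= psi w) ->
  rintegrable psi -> rintegrable phi.
Proof.
move=> mphi le; apply: le_integrable => //; first exact/measurable_EFinP.
move=> w _ /=; have /andP[p0 pp] := le w.
by rewrite lee_fin !ger0_norm// (le_trans p0).
Qed.

Lemma rintegrableD phi psi : rintegrable phi -> rintegrable psi ->
  rintegrable (fun w => phi w + psi w).
Proof. by move=> h1 h2; exact: (integrableD measurableT h1 h2). Qed.

Lemma rintegrableZ (c : R) phi : rintegrable phi -> rintegrable (fun w => c * phi w).
Proof. by move=> h; exact: (integrableZl measurableT c h). Qed.

Lemma rintegrable_cst (c : R) : rintegrable (fun=> c).
Proof. exact: (finite_measure_integrable_cst P c measurableT). Qed.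

Lemma rintegrable_sum (I : Type) (s : seq I) (h : I -> T -> R) :
  (forall i, rintegrable (h i)) -> rintegrable (fun w => \sum_(i <- s) h i w).
Proof.
move=> hi; rewrite /rintegrable; have := @integrable_sum _ _ _ P setT measurableT I s predT
  (fun i w => (h i w)%:E) (fun i _ => hi i).
by apply: eq_integrable => // w _; rewrite /= sumEFin.
Qed.

Lemma RexpD phi psi : rintegrable phi -> rintegrable psi ->
  \int[P]_w (phi w + psi w) = \int[P]_w phi w + \int[P]_w psi w.
Proof. exact: RintegralD. Qed.

Lemma RexpZ (c : R) phi : rintegrable phi -> \int[P]_w (c * phi w) = c * \int[P]_w phi w.
Proof. exact: RintegralZl. Qed.

Lemma Rexp_cst (c : R) : \int[P]_w (cst c w) = c.
Proof.
rewrite Rintegral_cst//; transitivity (c * fine (1%E : \bar R)); last by rewrite /= mulr1.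
by congr (_ * fine _); exact: probability_setT.
Qed.

Lemma Rexp_le phi psi : rintegrable phi -> rintegrable psi ->
  (forall w, phi w <= psi w) -> \int[P]_w phi w <= \int[P]_w psi w.
Proof. by move=> h1 h2 h; apply: le_Rintegral. Qed.

Lemma Rexp_ge0 phi : (forall w, 0 <= phi w) -> 0 <= \int[P]_w phi w.
Proof. by move=> h; apply: Rintegral_ge0. Qed.

Lemma Rexp_sum (I : Type) (s : seq I) (h : I -> T -> R) :
  (forall i, rintegrable (h i)) ->
  \int[P]_w (\sum_(i <- s) h i w) = \sum_(i <- s) \int[P]_w h i w.
Proof.
move=> hi; elim: s => [|i s IH].
  rewrite big_nil -[RHS](Rexp_cst 0); apply: eq_Rintegral => w _; by rewrite big_nil.
rewrite big_cons -IH -RexpD//; last exact: rintegrable_sum.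
by apply: eq_Rintegral => w _; rewrite big_cons.
Qed.

Lemma EFin_Rexp phi : rintegrable phi -> (\int[P]_w (phi w)%:E)%E = (\int[P]_w phi w)%:E.
Proof. by move=> h; rewrite /Rintegral fineK//; exact: integrable_fin_num. Qed.

(** The extended integral of a nonnegative function always makes sense, so bounding it gives
    integrability together with the real bound. The noise terms become integrable in this way. *)
Lemma Rexp_le_of_integral_le phi (c : R) : measurable_fun setT phi -> (forall w, 0 <= phi w) ->
  (\int[P]_w (phi w)%:E <= c%:E)%E -> rintegrable phi /\ \int[P]_w phi w <= c.
Proof.
move=> mphi phi0 le.
have h : rintegrable phi.
  apply/integrableP; split; first exact/measurable_EFinP.
  apply: (@le_lt_trans _ _ c%:E); last exact: ltry.
  by under eq_integral do rewrite /= ger0_norm//.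
by split => //; rewrite -lee_fin -EFin_Rexp.
Qed.
End RealExpectation.

(** * Measurability of matrix and parameter operations *)

Section ParamMeasurability.
Context (R : realType) (NL : nat) (m n r : 'I_NL -> nat).
Local Notation V := (param R m n).
Context (d : measure_display) (T : measurableType d).
Implicit Types (x y : T -> V).

Lemma measurable_mxD p q (A B : T -> 'M[R]_(p, q)) : measurable_mx A -> measurable_mx B ->
  measurable_mx (fun u => A u + B u).
Proof.
move=> hA hB i j; under eq_fun do rewrite mxE; exact: measurable_funD.
Qed.

Lemma measurable_mxZ p q c (A : T -> 'M[R]_(p, q)) : measurable_mx A ->
  measurable_mx (fun u => c *: A u).
Proof.
by move=> hA i j; under eq_fun do rewrite mxE; apply: measurable_funM.
Qed.

Lemma measurable_mxB p q (A B : T -> 'M[R]_(p, q)) : measurable_mx A -> measurable_mx B ->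
  measurable_mx (fun u => A u - B u).
Proof.
move=> hA hB; under eq_fun do rewrite -scaleN1r; apply: measurable_mxD => //.
exact: measurable_mxZ.
Qed.

Lemma measurable_mxT p q (A : T -> 'M[R]_(p, q)) : measurable_mx A ->
  measurable_mx (fun u => (A u)^T).
Proof. by move=> hA i j; under eq_fun do rewrite mxE; exact: hA. Qed.

Lemma measurable_mxM p q k (A : T -> 'M[R]_(p, q)) (B : T -> 'M[R]_(q, k)) :
  measurable_mx A -> measurable_mx B -> measurable_mx (fun u => A u *m B u).
Proof.
move=> hA hB i j; under eq_fun do rewrite mxE.
by apply: measurable_sum => c; apply: measurable_funM.
Qed.

Lemma measurable_mx_cst p q (A : 'M[R]_(p, q)) : measurable_mx (fun _ : T => A).
Proof. by move=> i j; exact: measurable_cst. Qed.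

Lemma measurable_paramD x y : measurable_param x -> measurable_param y ->
  measurable_param (fun u => x u + y u).
Proof. by move=> hx hy l; exact: (measurable_mxD (hx l) (hy l)). Qed.

Lemma measurable_paramZ c x : measurable_param x -> measurable_param (fun u => c *: x u).
Proof. by move=> hx l; exact: (measurable_mxZ c (hx l)). Qed.

Lemma measurable_paramB x y : measurable_param x -> measurable_param y ->
  measurable_param (fun u => x u - y u).
Proof. by move=> hx hy l; exact: (measurable_mxB (hx l) (hy l)). Qed.

Lemma measurable_param_cst (x : V) : measurable_param (fun _ : T => x).
Proof. by move=> l i j; exact: measurable_cst. Qed.

Lemma measurable_param_sum (I : Type) (s : seq I) (h : I -> T -> V) :
  (forall i, measurable_param (h i)) -> measurable_param (fun u => \sum_(i <- s) h i u).
Proof.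
move=> hh; elim: s => [|i s IH].
  by under eq_fun do rewrite big_nil; exact: measurable_param_cst.
by under eq_fun do rewrite big_cons; exact: measurable_paramD.
Qed.

Lemma measurable_pinner x y : measurable_param x -> measurable_param y ->
  measurable_fun setT (fun u => pinner (x u) (y u)).
Proof.
move=> hx hy; apply: measurable_sum => l; apply: measurable_sum => i.
by apply: measurable_sum => j; apply: measurable_funM; [exact: hx|exact: hy].
Qed.

Lemma measurable_psqnorm x : measurable_param x -> measurable_fun setT (fun u => psqnorm (x u)).
Proof. by move=> hx; exact: measurable_pinner. Qed.
End ParamMeasurability.

Lemma measurable_param_comp (R : realType) (NL : nat) (m n : 'I_NL -> nat)
    (d d' : measure_display) (T : measurableType d) (T' : measurableType d')
    (x : T -> param R m n) (h : T' -> T) :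
  measurable_param x -> measurable_fun setT h -> measurable_param (fun u => x (h u)).
Proof. by move=> hx hh l i j; exact: (measurableT_comp (hx l i j) hh). Qed.

Lemma measurable_mx_comp (R : realType) (p q : nat)
    (d d' : measure_display) (T : measurableType d) (T' : measurableType d')
    (x : T -> 'M[R]_(p, q)) (h : T' -> T) :
  measurable_mx x -> measurable_fun setT h -> measurable_mx (fun u => x (h u)).
Proof. by move=> hx hh i j; exact: (measurableT_comp (hx i j) hh). Qed.

(** * Mean and variance of the gradient noise *)

Section GradientNoise.
Context (R : realType) (NL : nat) (m n : 'I_NL -> nat).
Local Notation V := (param R m n).
Context (dX : measure_display) (Xi : measurableType dX) (D : probability Xi R).
Context (gradf : V -> V) (gradF : V -> Xi -> V) (sigma_l : 'I_NL -> R).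
Hypothesis mgradF : forall (d' : measure_display) (T' : measurableType d')
  (y : T' -> V) (w : T' -> Xi), measurable_param y -> measurable_fun setT w ->
  measurable_param (fun u => gradF (y u) (w u)).
Hypothesis gradF_mean : forall x l i j,
  D.-integrable setT (fun z => (gradF x z l i j)%:E) /\
  (\int[D]_z (gradF x z l i j)%:E = (gradf x l i j)%:E)%E.
Hypothesis gradF_var : forall x l,
  (\int[D]_z (frob_sq (gradF x z l - gradf x l))%:E <= ((sigma_l l) ^+ 2)%:E)%E.

(** The gradient of [f] is the mean of the jointly measurable [gradF]; Tonelli's theorem is applied
    to its positive and negative parts. *)
Lemma measurable_gradf (d' : measure_display) (T' : measurableType d') (y : T' -> V) :
  measurable_param y -> measurable_param (fun u => gradf (y u)).
Proof.
move=> my l i j; apply/measurable_EFinP.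
pose phi (u : T' * Xi) : \bar R := (gradF (y u.1) u.2 l i j)%:E.
have mphi : measurable_fun setT phi.
  apply/measurable_EFinP.
  exact: (mgradF (measurable_param_comp my measurable_fst) measurable_snd).
have -> : EFin \o (fun u => gradf (y u) l i j) =
    (fun u => fubini_F D (phi^\+)%E u - fubini_F D (phi^\-)%E u)%E.
  apply/funext => u /=; rewrite -(gradF_mean (y u) i j).2 integralE.
  by congr (_ - _)%E; apply: eq_integral => z _; rewrite ?funeposE ?funenegE.
apply: emeasurable_funB.
  by apply: measurable_fun_fubini_tonelli_F => //; exact: measurable_funepos.
by apply: measurable_fun_fubini_tonelli_F => //; exact: measurable_funeneg.
Qed.

Local Notation noise x z := (gradF x z - gradf x).

Lemma measurable_noise x : measurable_param (fun z => noise x z).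
Proof.
apply: measurable_paramB; last exact: measurable_param_cst.
by apply: mgradF => //; exact: measurable_param_cst.
Qed.

Lemma noise_inner x (b : V) :
  rintegrable D (fun z => pinner b (noise x z)) /\ \int[D]_z pinner b (noise x z) = 0.
Proof.
have mean l i j : rintegrable D (fun z => b l i j * (gradF x z l i j + - gradf x l i j)) /\
    \int[D]_z (b l i j * (gradF x z l i j + - gradf x l i j)) = 0.
  have [int_ij E] := gradF_mean x i j.
  have int2 : rintegrable D (fun z => gradF x z l i j + - gradf x l i j).
    by apply: rintegrableD => //; exact: rintegrable_cst.
  split; first exact: rintegrableZ.
  rewrite RexpZ// RexpD//; last exact: rintegrable_cst.
  by rewrite Rexp_cst /Rintegral E /= subrr mulr0.
have -> : (fun z => pinner b (noise x z)) = (fun z => \sum_(l < NL) \sum_(i < m l)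
    \sum_(j < n l) b l i j * (gradF x z l i j + - gradf x l i j)).
  apply/funext => z; apply: eq_bigr => l _; apply: eq_bigr => i _; apply: eq_bigr => j _.
  by rewrite !mxE.
have i1 l i : rintegrable D (fun z => \sum_(j < n l) b l i j *
    (gradF x z l i j + - gradf x l i j)).
  by apply: rintegrable_sum => j; case: (mean l i j).
have i2 l : rintegrable D (fun z => \sum_(i < m l) \sum_(j < n l) b l i j *
    (gradF x z l i j + - gradf x l i j)) by apply: rintegrable_sum.
split; first exact: rintegrable_sum.
rewrite Rexp_sum//; apply: big1 => l _; rewrite Rexp_sum//; apply: big1 => i _.
rewrite Rexp_sum; last by move=> j; case: (mean l i j).
by apply: big1 => j _; case: (mean l i j).
Qed.

Lemma noise_variance x :
  rintegrable D (fun z => psqnorm (noise x z)) /\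
  \int[D]_z psqnorm (noise x z) <= \sum_(l < NL) sigma_l l ^+ 2.
Proof.
apply: Rexp_le_of_integral_le.
- exact: measurable_psqnorm (measurable_noise x).
- by move=> z; exact: psqnorm_ge0.
- under eq_integral do rewrite /psqnorm /pinner -sumEFin.
  rewrite ge0_integral_sum//.
  + by rewrite -sumEFin; apply: lee_sum => l _; exact: gradF_var.
  + move=> l; apply/measurable_EFinP; apply: measurable_sum => i; apply: measurable_sum => j.
    by apply: measurable_funM; exact: (measurable_noise x).
  + by move=> l z _; rewrite lee_fin; exact: frob_sq_ge0.
Qed.

Lemma noise_projected_integral (Pi : V -> V) (a x : V) (c : R) : orthoproj Pi ->
  (forall y : Xi -> V, measurable_param y -> measurable_param (fun z => Pi (y z))) ->
  (\int[D]_z (psqnorm (Pi (a + c *: noise x z)))%:E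
    <= (psqnorm (Pi a) + c ^+ 2 * \sum_(l < NL) sigma_l l ^+ 2)%:E)%E.
Proof.
move=> oPi mPi; have [_ sym idem] := oPi.
have [ni nE] := noise_inner x (Pi a); have [vi vE] := noise_variance x.
pose psi z := psqnorm (Pi a) + ((2 * c) * pinner (Pi a) (noise x z) +
  c ^+ 2 * psqnorm (noise x z)).
have psii : rintegrable D psi.
  apply: rintegrableD; first exact: rintegrable_cst.
  by apply: rintegrableD; exact: rintegrableZ.
have le z : 0 <= psqnorm (Pi (a + c *: noise x z)) <= psi z.
  rewrite psqnorm_ge0 /= (orthoprojD oPi) (orthoprojZ oPi) psqnormD psqnormZ pinnerZr -addrA.
  rewrite /psi lerD2l; apply: lerD; last by rewrite ler_wpM2l ?sqr_ge0 ?orthoproj_le.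
  (* Self-adjointness moves the projection off the noise, so the cross term is a fixed vector paired
     with the noise and has mean zero. *)
  by rewrite -sym idem mulrA.
have mm : measurable_fun setT (fun z => psqnorm (Pi (a + c *: noise x z))).
  apply/measurable_psqnorm/mPi/measurable_paramD; first exact: measurable_param_cst.
  exact/measurable_paramZ/measurable_noise.
have ii := rintegrable_le mm le psii.
rewrite EFin_Rexp// lee_fin; apply: (@le_trans _ _ (\int[D]_z psi z)).
  by apply: Rexp_le => // z; case/andP: (le z).
rewrite RexpD; [|exact: rintegrable_cst|by apply: rintegrableD; exact: rintegrableZ].
rewrite Rexp_cst lerD2l RexpD; [|exact: rintegrableZ|exact: rintegrableZ].
by rewrite !RexpZ// nE mulr0 add0r ler_wpM2l ?sqr_ge0.
Qed.

Context (dO : measure_display) (Omega : measurableType dO) (P : probability Omega R)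
  (J : eqType) (xi : J -> Omega -> Xi).
Hypothesis iid : iid_family P D xi.

(** The projection may be random as long as it is determined by the past: once the past is fixed,
    [Pi], [a] and [x] are constants. Its measurability is asked over arbitrary spaces because it is
    used on pairs of past and sample. *)
Lemma noise_step (S : pred J) (j : J) (Pi : sigma_past xi S -> V -> V)
    (a x : sigma_past xi S -> V) (c : R) : j \notin S ->
  (forall w, orthoproj (Pi w)) ->
  (forall (d' : measure_display) (T' : measurableType d') (h : T' -> sigma_past xi S)
     (y : T' -> V), measurable_fun setT h -> measurable_param y ->
     measurable_param (fun u => Pi (h u) (y u))) ->
  measurable_param a -> measurable_param x ->
  rintegrable P (fun w => psqnorm (Pi w (a w))) ->
  rintegrable P (fun w => psqnorm (Pi w (a w + c *: noise (x w) (xi j w)))) /\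
  \int[P]_w psqnorm (Pi w (a w + c *: noise (x w) (xi j w)))
    <= \int[P]_w psqnorm (Pi w (a w)) + c ^+ 2 * \sum_(l < NL) sigma_l l ^+ 2.
Proof.
move=> jS oPi mPi ma mx ia.
pose phi (u : sigma_past xi S * Xi) : R :=
  psqnorm (Pi u.1 (a u.1 + c *: noise (x u.1) u.2)).
have mx1 := measurable_param_comp mx (@measurable_fst _ _ (sigma_past xi S) Xi).
have mphi : measurable_fun setT phi.
  apply/measurable_psqnorm/mPi; first exact: measurable_fst.
  apply: measurable_paramD; first exact: (measurable_param_comp ma measurable_fst).
  apply/measurable_paramZ/measurable_paramB; last exact: measurable_gradf.
  by apply: mgradF => //; exact: measurable_snd.
have mphiE : measurable_fun setT (fun u => (phi u)%:E) by exact/measurable_EFinP.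
have mid : measurable_fun setT (idfun : Omega -> sigma_past xi S).
  by move=> _ B mB; rewrite setTI; exact: (sigma_past_le iid mB).
have mpair : measurable_fun setT (fun w : Omega => ((w : sigma_past xi S), xi j w)).
  exact: (measurable_fun_pair mid (iid_measurable iid j)).
have phi0 u : (0 <= (phi u)%:E)%E by rewrite lee_fin psqnorm_ge0.
apply: Rexp_le_of_integral_le.
- exact: (measurableT_comp mphi mpair).
- by move=> w; exact: psqnorm_ge0.
- have := integral_indep iid jS mphiE phi0; rewrite /phi /= => ->.
  set s2 := \sum_(l < NL) _.
  have -> : (\int[P]_w psqnorm (Pi w (a w)) + c ^+ 2 * s2)%:E =
      (\int[P]_w (psqnorm (Pi w (a w)) + c ^+ 2 * s2)%:E)%E.
    rewrite EFin_Rexp; last by apply: rintegrableD => //; exact: rintegrable_cst.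
    by rewrite RexpD//; [rewrite Rexp_cst|exact: rintegrable_cst].
  have s20 : 0 <= s2 by apply: sumr_ge0 => l _; exact: sqr_ge0.
  apply: ge0_le_integral => //.
  + by move=> w _; apply: integral_ge0 => z _; exact: (phi0 (w, z)).
  + have mF := measurable_fun_fubini_tonelli_F (m2 := D) _ mphiE phi0.
    exact: (measurable_fun_sigma_past iid mF).
  + apply/measurable_EFinP; apply: measurable_funD => //.
    exact: rintegrable_measurable ia.
  + move=> w _; apply: noise_projected_integral => // y my.
    by apply: (mPi _ _ (fun=> w)) => //.
Qed.
End GradientNoise.

(** * The algorithm as projected momentum descent *)

Section GaloreAlgebra.
Context (R : realType) (NL : nat) (m n r : 'I_NL -> nat) (Xi : Type).
Local Notation V := (param R m n).
Local Notation state := (gstate R m n r).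

Definition gproj (s : state) (y : V) : V := fun l => lproj (lP (s l)) (lQ (s l)) (y l).

(* The projected momentum, lifted back to the full parameter space. *)
Definition gmom (s : state) : V := fun l =>
  if (m l <= n l)%N then lP (s l) *m lML (s l) else lMR (s l) *m (lQ (s l))^T.

Definition gorth (s : state) : Prop := forall l,
  (lP (s l))^T *m lP (s l) = 1%:M /\ (lQ (s l))^T *m lQ (s l) = 1%:M.

Lemma gproj_orthoproj (s : state) : gorth s -> orthoproj (gproj s).
Proof.
move=> os; split=> [a x y|x y|x].
- apply: functional_extensionality_dep => l.
  change (lproj (lP (s l)) (lQ (s l)) (a *: x l + y l) =
    a *: lproj (lP (s l)) (lQ (s l)) (x l) + lproj (lP (s l)) (lQ (s l)) (y l)).
  rewrite /lproj; case: (m l <= n l)%N; first by rewrite mulmxDr scalemxAr.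
  by rewrite !mulmxDl !scalemxAl.
- apply: eq_bigr => l _; rewrite /gproj /lproj; case: (m l <= n l)%N.
    by rewrite -!mulmxA !frob_inner_mull trmxK.
  by rewrite !frob_inner_mulr trmxK.
- apply: functional_extensionality_dep => l; have [oP oQ] := os l.
  rewrite /gproj /lproj; case: (m l <= n l)%N.
    by rewrite !mulmxA -(mulmxA (lP (s l))) oP mulmx1.
  by rewrite -!mulmxA (mulmxA (lQ (s l))^T) oQ mul1mx.
Qed.

Context (beta eta : R) (tau Bsz : nat) (gradF : V -> Xi -> V)
  (svdP : nat -> forall l : 'I_NL, 'M[R]_(m l, n l) -> 'M[R]_(m l, r l))
  (svdQ : nat -> forall l : 'I_NL, 'M[R]_(m l, n l) -> 'M[R]_(n l, r l))
  (samples : nat -> nat -> Xi) (x0 : V).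

Local Notation st := (galore_state beta eta tau Bsz gradF svdP svdQ samples x0).
Local Notation G t := (stoch_grad tau Bsz gradF samples t (gX (st t))).

Lemma stoch_gradE t x : stoch_grad tau Bsz gradF samples t x =
  if (t %% tau == 0)%N then Bsz%:R^-1 *: \sum_(b < Bsz) gradF x (samples t b)
  else gradF x (samples t 0%N).
Proof.
rewrite /stoch_grad; apply: functional_extensionality_dep => l; case: (t %% tau == 0)%N => //.
transitivity (Bsz%:R^-1 *: (\sum_(b < Bsz) gradF x (samples t b)) l); last by [].
by rewrite param_sumE.
Qed.

Lemma gX_step t : gX (st t.+1) = gX (st t) - eta *: gmom (st t.+1).
Proof.
apply: functional_extensionality_dep => l.
transitivity (gX (st t) l - eta *: gmom (st t.+1) l); last by [].
by rewrite /gX /gmom /= /lstep /=; case: (m l <= n l)%N.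
Qed.

(** This is the purpose of momentum projection: lifting the re-expressed old momentum by the new
    basis gives exactly the new projector applied to the old lifted momentum. *)
Lemma gmom_step t :
  gmom (st t.+1) = gproj (st t.+1) ((1 - beta) *: gmom (st t) + beta *: G t).
Proof.
apply: functional_extensionality_dep => l.
transitivity (lproj (lP (st t.+1 l)) (lQ (st t.+1 l))
  ((1 - beta) *: gmom (st t) l + beta *: G t l)); last by [].
rewrite /gmom /lproj /=; case: (m l <= n l)%N; rewrite /lstep /=.
  by rewrite !mulmxDr -!scalemxAr !mulmxA.
by rewrite !mulmxDl -!scalemxAl ?mulmxA.
Qed.

Lemma gmom_init : gmom (st 0) = 0.
Proof.
by apply: functional_extensionality_dep => l; rewrite /gmom /=; case: (m l <= n l)%N;
  rewrite mul0mx.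
Qed.

Lemma gproj_lazy t : (t %% tau != 0)%N -> gproj (st t.+1) = gproj (st t).
Proof.
move=> /negbTE tn; apply/funext => y; apply: functional_extensionality_dep => l.
by rewrite /gproj /= /lstep tn.
Qed.

Hypothesis rank_lt : (forall l, 0 < r l < minn (m l) (n l))%N.
Hypothesis svdPQ : forall t l (A : 'M[R]_(m l, n l)), exists U S W, is_svd A U S W /\
  svdP t A = firstcols (r l) U /\ svdQ t A = firstcols (r l) W.

(** State [t.+1] stores the bases of iteration [t]. State 0 holds zero matrices, so orthonormality
    starts at 1, where iteration 0 has refreshed. *)
Lemma gorth_step t : gorth (st t.+1).
Proof.
have rP l : (r l <= m l)%N.
  have /andP[_ h] := rank_lt l; exact: (leq_trans (ltnW h) (geq_minl _ _)).
have rQ l : (r l <= n l)%N.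
  have /andP[_ h] := rank_lt l; exact: (leq_trans (ltnW h) (geq_minr _ _)).
have svd_orth s l (A : 'M[R]_(m l, n l)) :
    (svdP s A)^T *m svdP s A = 1%:M /\ (svdQ s A)^T *m svdQ s A = 1%:M.
  have [U [S [W [[UU WW _ _ _] [-> ->]]]]] := svdPQ s A.
  by rewrite !firstcols_orth.
elim: t => [|t IH] l; first by rewrite /= /lstep mod0n /=; exact: svd_orth.
rewrite [galore_state _ _ _ _ _ _ _ _ _ t.+2]/= {1 2 3 4}/lstep /=.
by case: ifP => _; [exact: svd_orth|exact: IH].
Qed.

Lemma gproj_refresh_le (dl : R) t : (t %% tau == 0)%N ->
  (forall l, dl <= (r l)%:R / (minn (m l) (n l))%:R) ->
  psqnorm (G t - gproj (st t.+1) (G t)) <= (1 - dl) * psqnorm (G t).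
Proof.
move=> t0 dlP; rewrite /psqnorm /pinner mulr_sumr; apply: ler_sum => l _.
rewrite -/(frob_sq (G t l)) -/(frob_sq ((G t - gproj (st t.+1) (G t)) l)).
change ((G t - gproj (st t.+1) (G t)) l)
  with (G t l - lproj (lP (st t.+1 l)) (lQ (st t.+1 l)) (G t l)).
set A := G t l.
have -> : lP (st t.+1 l) = svdP t A by rewrite /= /lstep t0.
have -> : lQ (st t.+1 l) = svdQ t A by rewrite /= /lstep t0.
have [U [S [W [svdA [-> ->]]]]] := svdPQ t A.
apply: (le_trans (svd_lproj_le (rank_lt l) svdA)).
by rewrite ler_wpM2r ?frob_sq_ge0// lerB.
Qed.
End GaloreAlgebra.

(** * Measurability of the state as a function of the samples *)

Section StateMeasurability.
Context (R : realType) (NL : nat) (m n r : 'I_NL -> nat).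
Context (dX : measure_display) (Xi : measurableType dX).
Local Notation V := (param R m n).
Local Notation state := (gstate R m n r).

Definition measurable_state (d : measure_display) (T : measurableType d) (s : T -> state) :=
  forall l, [/\ measurable_mx (fun u => lX (s u l)), measurable_mx (fun u => lP (s u l)),
    measurable_mx (fun u => lQ (s u l)), measurable_mx (fun u => lML (s u l)) &
    measurable_mx (fun u => lMR (s u l))].

Lemma measurable_gproj (d : measure_display) (T : measurableType d) (s : T -> state)
    (y : T -> V) : measurable_state s -> measurable_param y ->
  measurable_param (fun u => gproj (s u) (y u)).
Proof.
move=> ms my l; have [_ mP mQ _ _] := ms l.
rewrite /gproj /lproj; case: (m l <= n l)%N.
  apply: measurable_mxM; last exact: (my l).
  by apply: measurable_mxM => //; exact: measurable_mxT.
by apply: measurable_mxM; [apply: measurable_mxM => //; exact: (my l)|exact: measurable_mxT].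
Qed.

Lemma measurable_gmom (d : measure_display) (T : measurableType d) (s : T -> state) :
  measurable_state s -> measurable_param (fun u => gmom (s u)).
Proof.
move=> ms l; have [_ mP mQ mML mMR] := ms l.
rewrite /gmom; case: (m l <= n l)%N; first exact: measurable_mxM.
by apply: measurable_mxM => //; exact: measurable_mxT.
Qed.

Lemma measurable_state_comp (d d' : measure_display) (T : measurableType d)
    (T' : measurableType d') (s : T -> state) (h : T' -> T) :
  measurable_state s -> measurable_fun setT h -> measurable_state (fun u => s (h u)).
Proof.
by move=> ms mh l; have [? ? ? ? ?] := ms l; split;
  apply: (@measurable_mx_comp _ _ _ _ _ _ _ (fun u => _ (s u l)) h).
Qed.

Context (beta eta : R) (tau Bsz : nat) (gradF : V -> Xi -> V)
  (svdP : nat -> forall l : 'I_NL, 'M[R]_(m l, n l) -> 'M[R]_(m l, r l))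
  (svdQ : nat -> forall l : 'I_NL, 'M[R]_(m l, n l) -> 'M[R]_(n l, r l)) (x0 : V).
Hypothesis mgradF : forall (d' : measure_display) (T' : measurableType d')
  (y : T' -> V) (w : T' -> Xi), measurable_param y -> measurable_fun setT w ->
  measurable_param (fun u => gradF (y u) (w u)).
Hypothesis msvd : forall t l (d' : measure_display) (T' : measurableType d')
  (y : T' -> 'M[R]_(m l, n l)), measurable_mx y ->
  measurable_mx (fun u => svdP t (y u)) /\ measurable_mx (fun u => svdQ t (y u)).

Lemma measurable_stoch_grad (d : measure_display) (T : measurableType d)
    (samples : T -> nat -> nat -> Xi) (t : nat) (x : T -> V) :
  (forall b, measurable_fun setT (fun u => samples u t b)) -> measurable_param x ->
  measurable_param (fun u => stoch_grad tau Bsz gradF (samples u) t (x u)).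
Proof.
move=> ms mx; under eq_fun do rewrite stoch_gradE.
case: (t %% tau == 0)%N; last exact: mgradF.
by apply/measurable_paramZ/measurable_param_sum => b; exact: mgradF.
Qed.

(** Asking only for samples of iterations before [t] is what later makes the state measurable with
    respect to the past. *)
Lemma measurable_galore_state (d : measure_display) (T : measurableType d)
    (samples : T -> nat -> nat -> Xi) (t : nat) :
  (forall s b, (s < t)%N -> measurable_fun setT (fun u => samples u s b)) ->
  measurable_state (fun u => galore_state beta eta tau Bsz gradF svdP svdQ (samples u) x0 t).
Proof.
elim: t => [_ l|t IH ms].
  by split; exact: measurable_mx_cst.
have {}IH := IH (fun s b st => ms s b (ltnW st)).
pose s u := galore_state beta eta tau Bsz gradF svdP svdQ (samples u) x0 t.
rewrite -/s in IH.
have mX : measurable_param (fun u => gX (s u)) by move=> l; case: (IH l).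
pose G u := stoch_grad tau Bsz gradF (samples u) t (gX (s u)).
have mG : measurable_param G by apply: measurable_stoch_grad => // b; exact: ms.
move=> l; have [mXl mPl mQl mML mMR] := IH l.
have [mP' mQ'] := @msvd t l _ _ _ (mG l).
have mP : measurable_mx (fun u => if (t %% tau == 0)%N then svdP t (G u l) else lP (s u l)).
  by case: (t %% tau == 0)%N.
have mQ : measurable_mx (fun u => if (t %% tau == 0)%N then svdQ t (G u l) else lQ (s u l)).
  by case: (t %% tau == 0)%N.
set Pt := (fun u => if _ then svdP _ _ else _) in mP.
set Qt := (fun u => if _ then svdQ _ _ else _) in mQ.
have mML' : measurable_mx (fun u => (1 - beta) *: ((Pt u)^T *m lP (s u l) *m lML (s u l)) +
    beta *: ((Pt u)^T *m G u l)).
  apply: measurable_mxD; apply: measurable_mxZ; apply: measurable_mxM => //.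
  - by apply: measurable_mxM => //; exact: measurable_mxT.
  - exact: measurable_mxT.
have mMR' : measurable_mx (fun u => (1 - beta) *: (lMR (s u l) *m (lQ (s u l))^T *m Qt u) +
    beta *: (G u l *m Qt u)).
  apply: measurable_mxD; apply: measurable_mxZ; apply: measurable_mxM => //.
  by apply: measurable_mxM => //; exact: measurable_mxT.
split => //=; rewrite /lstep /=.
case: (m l <= n l)%N; apply: measurable_mxB => //; apply: measurable_mxZ.
  exact: measurable_mxM.
by apply: measurable_mxM => //; exact: measurable_mxT.
Qed.
End StateMeasurability.

Lemma orthoproj_id (R : realType) (NL : nat) (m n : 'I_NL -> nat) :
  orthoproj (fun y : param R m n => y).
Proof. by split. Qed.

(** * The random trajectory and its expected recursions *)

Section Trajectory.
Context (R : realType) (NL : nat) (m n r : 'I_NL -> nat).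
Context (dX : measure_display) (Xi : measurableType dX) (D : probability Xi R).
Context (dO : measure_display) (Omega : measurableType dO) (P : probability Omega R).
Context (xi : nat * nat -> Omega -> Xi).
Local Notation V := (param R m n).
Context (f : V -> R) (gradf : V -> V) (gradF : V -> Xi -> V).
Context (L : R) (sigma_l : 'I_NL -> R) (x0 : V).
Context (svdP : nat -> forall l : 'I_NL, 'M[R]_(m l, n l) -> 'M[R]_(m l, r l))
  (svdQ : nat -> forall l : 'I_NL, 'M[R]_(m l, n l) -> 'M[R]_(n l, r l)).
Context (tau Bsz : nat) (beta eta dl : R).

Hypothesis rank_lt : (forall l, 0 < r l < minn (m l) (n l))%N.
Hypothesis f_grad : is_gradient f gradf.
Hypothesis mgradF : forall (d' : measure_display) (T' : measurableType d')
  (y : T' -> V) (w : T' -> Xi), measurable_param y -> measurable_fun setT w ->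
  measurable_param (fun u => gradF (y u) (w u)).
Hypotheses (L_gt0 : 0 < L) (gradf_lip : lipschitz_grad gradf L).
Hypothesis gradF_mean : forall x l i j,
  D.-integrable setT (fun z => (gradF x z l i j)%:E) /\
  (\int[D]_z (gradF x z l i j)%:E = (gradf x l i j)%:E)%E.
Hypothesis gradF_var : forall x l,
  (\int[D]_z (frob_sq (gradF x z l - gradf x l))%:E <= ((sigma_l l) ^+ 2)%:E)%E.
Hypothesis iid : iid_family P D xi.
Hypothesis svdPQ : forall t l (A : 'M[R]_(m l, n l)), exists U S W, is_svd A U S W /\
  svdP t A = firstcols (r l) U /\ svdQ t A = firstcols (r l) W.
Hypothesis msvd : forall t l (d' : measure_display) (T' : measurableType d')
  (y : T' -> 'M[R]_(m l, n l)), measurable_mx y ->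
  measurable_mx (fun u => svdP t (y u)) /\ measurable_mx (fun u => svdQ t (y u)).
Hypothesis dl_le : forall l, dl <= (r l)%:R / (minn (m l) (n l))%:R.
Hypotheses (dl_itv : 0 < dl <= 1) (beta_itv : 0 < beta <= 1) (eta_gt0 : 0 < eta).
Hypothesis Bsz_gt0 : (0 < Bsz)%N.

Local Notation samp w := (fun s b => xi (s, b) w).
Local Notation sigma2 := (\sum_(l < NL) sigma_l l ^+ 2).

Definition tstate (t : nat) (w : Omega) :=
  galore_state beta eta tau Bsz gradF svdP svdQ (samp w) x0 t.
Definition titer t w : V := gX (tstate t w).
Definition tmom t w : V := gmom (tstate t w).
Definition tproj t w : V -> V := gproj (tstate t w).
Definition tgrad t w : V := gradf (titer t w).
Definition tsgrad t w : V := stoch_grad tau Bsz gradF (samp w) t (titer t w).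

(** Lexicographic order on samples: everything before iteration [t], and the first [b] samples of
    iteration [t] itself. *)
Definition past (t b : nat) : pred (nat * nat) :=
  fun i => (i.1 < t)%N || (i.1 == t) && (i.2 < b)%N.

(** Required for every [b], since a batch is integrated out one sample at a time with a growing
    past. *)
Definition adapted t (Y : Omega -> V) :=
  forall b, @measurable_param _ _ _ _ _ (sigma_past xi (past t b)) Y.

Lemma measurable_tstate t b : @measurable_state _ _ _ _ _ _ (sigma_past xi (past t b)) (tstate t).
Proof.
apply: (@measurable_galore_state _ _ _ _ _ _ _ _ _ _ _ _ _ _ _ mgradF msvd _
  (sigma_past xi (past t b)) (fun w => samp w)) => s c st.
by apply: measurable_sigma_past; rewrite /past unfold_in /= st.
Qed.

Lemma adapted_titer t : adapted t (titer t).
Proof. by move=> b l; case: (measurable_tstate t b l). Qed.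

Lemma adapted_tmom t : adapted t (tmom t).
Proof. by move=> b; exact: measurable_gmom (measurable_tstate t b). Qed.

Lemma adapted_tgrad t : adapted t (tgrad t).
Proof.
move=> b; exact: (measurable_gradf mgradF gradF_mean (@adapted_titer t b)).
Qed.

Lemma adapted_measurable t Y : adapted t Y -> measurable_param Y.
Proof. by move=> aY l i j; exact: (measurable_fun_sigma_past iid (@aY 0%N l i j)). Qed.

Lemma measurable_tstateO t : measurable_state (tstate t).
Proof.
apply: (@measurable_galore_state _ _ _ _ _ _ _ _ _ _ _ _ _ _ _ mgradF msvd _ Omega
  (fun w => samp w)) => s c _.
exact: (iid_measurable iid (s, c)).
Qed.

Lemma measurable_tsgrad t : measurable_param (tsgrad t).
Proof.
apply: (@measurable_stoch_grad _ _ _ _ _ _ _ _ _ mgradF _ Omega (fun w => samp w)).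
  by move=> b; exact: (iid_measurable iid (t, b)).
exact: adapted_measurable (@adapted_titer t).
Qed.

(** Sample [k] is independent of a past containing the earlier samples of its own batch, so each
    sample adds one variance and no cross terms appear. *)
Lemma batch_noise t (Y : Omega -> V) (c : R) k : adapted t Y ->
  rintegrable P (fun w => psqnorm (Y w)) ->
  let Z w := Y w + c *: \sum_(b < k) (gradF (titer t w) (xi (t, b : nat) w) - tgrad t w) in
  rintegrable P (fun w => psqnorm (Z w)) /\
  \int[P]_w psqnorm (Z w) <= \int[P]_w psqnorm (Y w) + k%:R * (c ^+ 2 * sigma2).
Proof.
move=> aY iY; elim: k => [|k [IHi IHle]] Z.
  have -> : Z = Y by apply/funext => w; rewrite /Z big_ord0 scaler0 addr0.
  by rewrite mul0r addr0.
pose a w := Y w + c *: \sum_(b < k) (gradF (titer t w) (xi (t, b : nat) w) - tgrad t w).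
have ma : @measurable_param _ _ _ _ _ (sigma_past xi (past t k)) a.
  apply: measurable_paramD; first exact: aY.
  apply/measurable_paramZ/measurable_param_sum => b.
  apply: measurable_paramB; last exact: adapted_tgrad.
  apply: mgradF; first exact: adapted_titer.
  by apply: measurable_sigma_past; rewrite /past unfold_in /= eqxx ltn_ord orbT.
have jS : (t, k) \notin past t k by rewrite /past unfold_in /= ltnn eqxx ltnn.
have [Hi Hle] := noise_step mgradF gradF_mean gradF_var iid
  (Pi := fun _ y => y) c jS (fun=> orthoproj_id R m n) (fun _ _ _ _ _ my => my) ma
  (@adapted_titer t k) IHi.
have -> : Z = fun w => a w + c *: (gradF (titer t w) (xi (t, k) w) - gradf (titer t w)).
  by apply/funext => w; rewrite /Z /a big_ord_recr /= scalerDr addrA.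
split => //; apply: (le_trans Hle); rewrite -natr1 mulrDl mul1r addrA lerD2r.
exact: IHle.
Qed.

Lemma refresh_noise t (Y : Omega -> V) (c : R) : (t %% tau == 0)%N -> adapted t Y ->
  rintegrable P (fun w => psqnorm (Y w)) ->
  rintegrable P (fun w => psqnorm (Y w + c *: (tsgrad t w - tgrad t w))) /\
  \int[P]_w psqnorm (Y w + c *: (tsgrad t w - tgrad t w))
    <= \int[P]_w psqnorm (Y w) + c ^+ 2 * (sigma2 / Bsz%:R).
Proof.
move=> t0 aY iY; have B0 : Bsz%:R != 0 :> R by rewrite pnatr_eq0 -lt0n.
have := @batch_noise t Y (c / Bsz%:R) Bsz aY iY; set Z := fun w => _ + _ => -[Hi Hle].
have E : Z = fun w => Y w + c *: (tsgrad t w - tgrad t w).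
  apply/funext => w; rewrite /Z; congr (_ + _).
  rewrite -scalerA; congr (_ *: _); rewrite /tsgrad stoch_gradE t0 sumrB scalerBr.
  by rewrite sumr_const card_ord -[tgrad t w *+ _]scaler_nat scalerA mulVf// scale1r.
rewrite E in Hi Hle; split => //; apply: (le_trans Hle); rewrite lerD2l.
rewrite le_eqVlt; apply/orP; left; apply/eqP; field; exact: B0.
Qed.

Lemma lazy_noise t (Y : Omega -> V) (c : R) : (t %% tau != 0)%N -> adapted t Y ->
  rintegrable P (fun w => psqnorm (Y w)) ->
  rintegrable P (fun w => psqnorm (Y w + c *: (tsgrad t w - tgrad t w))) /\
  \int[P]_w psqnorm (Y w + c *: (tsgrad t w - tgrad t w))
    <= \int[P]_w psqnorm (Y w) + c ^+ 2 * sigma2.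
Proof.
move=> /negbTE tn aY iY.
have jS : (t, 0%N) \notin past t 0 by rewrite /past unfold_in /= ltnn ltnn andbF.
have -> : tsgrad t = fun w => gradF (titer t w) (xi (t, 0%N) w).
  by apply/funext => w; rewrite /tsgrad stoch_gradE tn.
exact: (noise_step mgradF gradF_mean gradF_var iid
  (Pi := fun _ y => y) c jS (fun=> orthoproj_id R m n) (fun _ _ _ _ _ my => my) (@aY 0%N)
  (@adapted_titer t 0%N) iY).
Qed.

Lemma tproj_orthoproj t w : orthoproj (tproj t.+1 w).
Proof. exact/gproj_orthoproj/gorth_step. Qed.

(** [tproj t] is the projection of iteration [t - 1], hence known before the fresh sample, and it is
    still in force when iteration [t] does not refresh. *)
Lemma lazy_noise_proj t (Y : Omega -> V) (c : R) : (t %% tau != 0)%N -> adapted t Y ->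
  rintegrable P (fun w => psqnorm (tproj t w (Y w))) ->
  \int[P]_w psqnorm (tproj t w (Y w + c *: (tsgrad t w - tgrad t w)))
    <= \int[P]_w psqnorm (tproj t w (Y w)) + c ^+ 2 * sigma2.
Proof.
move=> tn aY iY.
have jS : (t, 0%N) \notin past t 0 by rewrite /past unfold_in /= ltnn ltnn andbF.
have oPi w : orthoproj (tproj t w).
  (* Iteration 0 always refreshes, so the zero bases of the initial state do not occur. *)
  by case: t tn {aY iY jS} => [|t _]; [rewrite mod0n|exact: tproj_orthoproj].
have mPi (d' : measure_display) (T' : measurableType d') (h : T' -> sigma_past xi (past t 0))
    (y : T' -> V) : measurable_fun setT h -> measurable_param y ->
    measurable_param (fun u => tproj t (h u) (y u)).
  by move=> mh my; apply: measurable_gproj => //;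
    exact: (measurable_state_comp (@measurable_tstate t 0%N) mh).
have -> : tsgrad t = fun w => gradF (titer t w) (xi (t, 0%N) w).
  by apply/funext => w; rewrite /tsgrad stoch_gradE (negbTE tn).
by have [] := noise_step mgradF gradF_mean gradF_var iid (Pi := tproj t) c jS oPi mPi
  (@aY 0%N) (@adapted_titer t 0%N) iY.
Qed.

Lemma sigma2_ge0 : 0 <= sigma2.
Proof. by apply: sumr_ge0 => l _; exact: sqr_ge0. Qed.

Lemma sgrad_noise t (Y : Omega -> V) (c : R) : adapted t Y ->
  rintegrable P (fun w => psqnorm (Y w)) ->
  rintegrable P (fun w => psqnorm (Y w + c *: (tsgrad t w - tgrad t w))) /\
  \int[P]_w psqnorm (Y w + c *: (tsgrad t w - tgrad t w))
    <= \int[P]_w psqnorm (Y w) + c ^+ 2 * sigma2.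
Proof.
move=> aY iY; have [t0|tn] := boolP (t %% tau == 0)%N; last exact: lazy_noise.
have [Hi Hle] := refresh_noise c t0 aY iY; split => //; apply: (le_trans Hle).
rewrite lerD2l ler_wpM2l ?sqr_ge0// ler_pdivrMr ?ltr0n// ler_peMr ?sigma2_ge0//.
by rewrite ler1n.
Qed.

(** * Square integrability along the trajectory *)

Lemma psqnorm_gradf_le (x y : V) :
  psqnorm (gradf x - gradf y) <= L ^+ 2 * psqnorm (x - y).
Proof.
rewrite -!sqr_pnorm -exprMn ler_sqr ?nnegrE ?pnorm_ge0//; first exact: gradf_lip.
by rewrite mulr_ge0 ?pnorm_ge0// ltW.
Qed.

Lemma rintegrable_psqnormD (x y : Omega -> V) : measurable_param x -> measurable_param y ->
  rintegrable P (fun w => psqnorm (x w)) -> rintegrable P (fun w => psqnorm (y w)) ->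
  rintegrable P (fun w => psqnorm (x w + y w)).
Proof.
move=> mx my ix iy.
apply: (rintegrable_le (psi := fun w => 2 * psqnorm (x w) + 2 * psqnorm (y w))).
- exact/measurable_psqnorm/measurable_paramD.
- by move=> w; rewrite psqnorm_ge0 psqnormD_le.
- by apply: rintegrableD; exact: rintegrableZ.
Qed.

Lemma rintegrable_psqnormZ (c : R) (x : Omega -> V) :
  rintegrable P (fun w => psqnorm (x w)) -> rintegrable P (fun w => psqnorm (c *: x w)).
Proof.
move=> ix; have -> : (fun w => psqnorm (c *: x w)) = (fun w => c ^+ 2 * psqnorm (x w)).
  by apply/funext => w; rewrite psqnormZ.
exact: rintegrableZ.
Qed.

Lemma rintegrable_psqnormB (x y : Omega -> V) : measurable_param x -> measurable_param y ->
  rintegrable P (fun w => psqnorm (x w)) -> rintegrable P (fun w => psqnorm (y w)) ->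
  rintegrable P (fun w => psqnorm (x w - y w)).
Proof.
move=> mx my ix iy; under eq_fun do rewrite -[- y _]scaleN1r.
by apply: rintegrable_psqnormD => //; [exact: measurable_paramZ|exact: rintegrable_psqnormZ].
Qed.

Lemma titer_step t w : titer t.+1 w = titer t w - eta *: tmom t.+1 w.
Proof. exact: gX_step. Qed.

Lemma tmom_step t w :
  tmom t.+1 w = tproj t.+1 w ((1 - beta) *: tmom t w + beta *: tsgrad t w).
Proof. exact: gmom_step. Qed.

Definition measurable_titer t := adapted_measurable (@adapted_titer t).
Definition measurable_tmom t := adapted_measurable (@adapted_tmom t).
Definition measurable_tgrad t := adapted_measurable (@adapted_tgrad t).

Lemma measurable_tproj t (y : Omega -> V) : measurable_param y ->
  measurable_param (fun w => tproj t w (y w)).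
Proof. by move=> my; apply: measurable_gproj => //; exact: measurable_tstateO. Qed.

Lemma rintegrable_tgrad_of_iter t : rintegrable P (fun w => psqnorm (titer t w - x0)) ->
  rintegrable P (fun w => psqnorm (tgrad t w)).
Proof.
move=> ix; apply: (rintegrable_le
    (psi := fun w => 2 * psqnorm (gradf x0) + 2 * (L ^+ 2 * psqnorm (titer t w - x0)))).
- exact/measurable_psqnorm/measurable_tgrad.
- move=> w; rewrite psqnorm_ge0 /= -[X in psqnorm X](subrK (gradf x0)) addrC.
  apply: (le_trans (psqnormD_le _ _)); rewrite lerD2l ler_wpM2l//.
  exact: psqnorm_gradf_le.
- apply: rintegrableD; first exact/rintegrableZ/rintegrable_cst.
  exact/rintegrableZ/rintegrableZ.
Qed.

Lemma rintegrable_tsgrad_of_iter t : rintegrable P (fun w => psqnorm (titer t w - x0)) ->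
  rintegrable P (fun w => psqnorm (tsgrad t w)).
Proof.
move=> /rintegrable_tgrad_of_iter ig.
have [Hi _] := sgrad_noise 1 (@adapted_tgrad t) ig.
rewrite (_ : (fun w => _) = fun w => psqnorm (tgrad t w + 1 *: (tsgrad t w - tgrad t w)))//.
by apply/funext => w; rewrite scale1r addrC subrK.
Qed.

Lemma rintegrable_tproj t (y : Omega -> V) : measurable_param y ->
  rintegrable P (fun w => psqnorm (y w)) ->
  rintegrable P (fun w => psqnorm (tproj t.+1 w (y w))).
Proof.
move=> my; apply: rintegrable_le; first exact/measurable_psqnorm/measurable_tproj.
by move=> w; rewrite psqnorm_ge0 orthoproj_le//; exact: tproj_orthoproj.
Qed.

(** Iterates and momentum go through one induction: distance to the deterministic [x0] bounds the
    gradient by smoothness, the noise has finite variance, and projecting does not increase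
    norms. *)
Lemma rintegrable_iter_mom t : rintegrable P (fun w => psqnorm (titer t w - x0)) /\
  rintegrable P (fun w => psqnorm (tmom t w)).
Proof.
elim: t => [|t [IHx IHm]].
  split.
    by under eq_fun do rewrite [titer 0 _ - _]subrr; exact: rintegrable_cst.
  by under eq_fun do rewrite /tmom gmom_init; exact: rintegrable_cst.
have iG := rintegrable_tsgrad_of_iter IHx.
have im : rintegrable P (fun w => psqnorm (tmom t.+1 w)).
  under eq_fun do rewrite tmom_step.
  apply: rintegrable_tproj.
    by apply: measurable_paramD; apply: measurable_paramZ;
      [exact: measurable_tmom|exact: measurable_tsgrad].
  apply: rintegrable_psqnormD; try exact: rintegrable_psqnormZ.
    exact/measurable_paramZ/measurable_tmom.
  exact/measurable_paramZ/measurable_tsgrad.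
split => //; under eq_fun do rewrite titer_step addrAC.
apply: rintegrable_psqnormB => //; last exact: rintegrable_psqnormZ.
  by apply: measurable_paramB; [exact: measurable_titer|exact: measurable_param_cst].
exact/measurable_paramZ/measurable_tmom.
Qed.

Lemma rintegrable_tmom t : rintegrable P (fun w => psqnorm (tmom t w)).
Proof. by case: (rintegrable_iter_mom t). Qed.

Lemma rintegrable_tgrad t : rintegrable P (fun w => psqnorm (tgrad t w)).
Proof. by apply: rintegrable_tgrad_of_iter; case: (rintegrable_iter_mom t). Qed.

(** In the next three definitions [t.+1] reads off the momentum and projection of iteration [t],
    which are stored in the following state. *)
Definition exp_grad t := \int[P]_w psqnorm (tgrad t w).
Definition exp_move t := \int[P]_w psqnorm (titer t.+1 w - titer t w).
Definition exp_err t := \int[P]_w psqnorm (tproj t.+1 w (tmom t.+1 w - tgrad t w)).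
Definition exp_compl t := \int[P]_w psqnorm (tgrad t w - tproj t.+1 w (tgrad t w)).

Lemma titer_moveE t w : titer t.+1 w - titer t w = - (eta *: tmom t.+1 w).
Proof. by rewrite titer_step addrAC subrr add0r. Qed.

Lemma rintegrable_move t : rintegrable P (fun w => psqnorm (titer t.+1 w - titer t w)).
Proof.
under eq_fun do rewrite titer_moveE psqnormN.
exact/rintegrable_psqnormZ/rintegrable_tmom.
Qed.

Lemma rintegrable_err t :
  rintegrable P (fun w => psqnorm (tproj t.+1 w (tmom t.+1 w - tgrad t w))).
Proof.
apply: rintegrable_tproj.
  by apply: measurable_paramB; [exact: measurable_tmom|exact: measurable_tgrad].
apply: rintegrable_psqnormB; [exact: measurable_tmom|exact: measurable_tgrad| |].
  exact: rintegrable_tmom.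
exact: rintegrable_tgrad.
Qed.

Lemma rintegrable_compl t :
  rintegrable P (fun w => psqnorm (tgrad t w - tproj t.+1 w (tgrad t w))).
Proof.
apply: rintegrable_psqnormB; [exact: measurable_tgrad| | |].
- exact/measurable_tproj/measurable_tgrad.
- exact: rintegrable_tgrad.
- by apply: rintegrable_tproj; [exact: measurable_tgrad|exact: rintegrable_tgrad].
Qed.

Lemma exp_grad_ge0 t : 0 <= exp_grad t.
Proof. by apply: Rexp_ge0 => w; exact: psqnorm_ge0. Qed.
Lemma exp_move_ge0 t : 0 <= exp_move t.
Proof. by apply: Rexp_ge0 => w; exact: psqnorm_ge0. Qed.
Lemma exp_err_ge0 t : 0 <= exp_err t.
Proof. by apply: Rexp_ge0 => w; exact: psqnorm_ge0. Qed.

Lemma exp_compl_le_grad t : exp_compl t <= exp_grad t.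
Proof.
apply: Rexp_le; [exact: rintegrable_compl|exact: rintegrable_tgrad|].
by move=> w; apply: orthoproj_compl_le; exact: tproj_orthoproj.
Qed.

Lemma tproj_err t w : tproj t.+1 w (tmom t.+1 w - tgrad t w) =
  tproj t.+1 w ((1 - beta) *: (tmom t w - tgrad t w) + beta *: (tsgrad t w - tgrad t w)).
Proof.
have oPi := tproj_orthoproj t w; have [_ _ idem] := oPi.
rewrite tmom_step orthoprojB// idem -orthoprojB//; congr (tproj _ _ _).
by rewrite !scalerBr addrACA -opprD -scalerDl subrK scale1r.
Qed.

(** Young's inequality with weight [beta] spends one of the two factors [1 - beta] on the drift [v]
    and keeps the other as contraction of [u]. *)
Lemma momentum_young (u v : V) :
  psqnorm ((1 - beta) *: (u + v)) <= (1 - beta) * psqnorm u + beta^-1 * psqnorm v.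
Proof.
have /andP[b0 b1] := beta_itv.
rewrite psqnormZ; set a := psqnorm u; set b := psqnorm v; set i := beta^-1.
have H := young_norm u v b0; rewrite -/a -/b -/i in H.
apply: (le_trans (ler_wpM2l (sqr_ge0 _) H)).
have a0 : 0 <= a := psqnorm_ge0 u; have bb0 : 0 <= b := psqnorm_ge0 v.
have ib : i * beta = 1 by rewrite mulVf// gt_eqF.
have c1 : (1 - beta) ^+ 2 * (1 + beta) <= 1 - beta.
  have -> : (1 - beta) ^+ 2 * (1 + beta) = (1 - beta) - (1 - beta) * (beta * beta) by ring.
  by rewrite gerBl mulr_ge0 ?subr_ge0// mulr_ge0// ltW.
have c2 : (1 - beta) ^+ 2 * (1 + i) <= i.
  have -> : (1 - beta) ^+ 2 * (1 + i) =
    i - (1 + beta * (1 - beta)) + (i * beta - 1) * (beta - 2) by ring.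
  rewrite ib subrr mul0r addr0 gerBl addr_ge0// mulr_ge0 ?subr_ge0//; exact: ltW.
by rewrite mulrDr !mulrA; apply: lerD; rewrite ler_wpM2r.
Qed.

Lemma drift_le (t k : nat) w : (k <= t)%N ->
  psqnorm (tgrad t w - tgrad k w) <=
  L ^+ 2 * ((t - k)%:R * \sum_(k <= s < t) psqnorm (titer s.+1 w - titer s w)).
Proof.
move=> kt; apply: (le_trans (psqnorm_gradf_le _ _)); rewrite ler_wpM2l ?sqr_ge0//.
rewrite -(telescope_sumr (fun s => titer s w) kt).
by apply: (le_trans (psqnorm_sum_le _ _)); rewrite size_iota.
Qed.

Lemma exp_drift_le (t k : nat) : (k <= t)%N ->
  rintegrable P (fun w => psqnorm (tgrad t w - tgrad k w)) /\
  \int[P]_w psqnorm (tgrad t w - tgrad k w) <=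
  L ^+ 2 * ((t - k)%:R * \sum_(k <= s < t) exp_move s).
Proof.
move=> kt.
have i1 : rintegrable P (fun w => psqnorm (tgrad t w - tgrad k w)).
  by apply: rintegrable_psqnormB; [exact: measurable_tgrad|exact: measurable_tgrad|
    exact: rintegrable_tgrad|exact: rintegrable_tgrad].
have i2 : rintegrable P (fun w => \sum_(k <= s < t) psqnorm (titer s.+1 w - titer s w)).
  by apply: rintegrable_sum => s; exact: rintegrable_move.
split => //; rewrite /exp_move -Rexp_sum; last by move=> s; exact: rintegrable_move.
rewrite -!RexpZ//; last exact: rintegrableZ.
by apply: Rexp_le => // [|w]; [exact/rintegrableZ/rintegrableZ|exact: drift_le].
Qed.

Lemma exp_grad_drift (t k : nat) : (k <= t)%N ->
  exp_grad t <= 2 * exp_grad k + 2 * (L ^+ 2 * ((t - k)%:R * \sum_(k <= s < t) exp_move s)).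
Proof.
move=> kt; have [i1 le1] := exp_drift_le kt.
apply: (@le_trans _ _ (2 * exp_grad k + 2 * \int[P]_w psqnorm (tgrad t w - tgrad k w))).
  rewrite -!RexpZ//; last exact: rintegrable_tgrad.
  rewrite -RexpD; [|exact/rintegrableZ/rintegrable_tgrad|exact: rintegrableZ].
  apply: Rexp_le; first exact: rintegrable_tgrad.
    by apply: rintegrableD; [exact/rintegrableZ/rintegrable_tgrad|exact: rintegrableZ].
  move=> w; rewrite -[X in psqnorm X <= _](subrK (tgrad k w)) addrC.
  exact: psqnormD_le.
by rewrite lerD2l ler_wpM2l.
Qed.

Let mom_gap_split t w : tmom t.+1 w - tgrad t.+1 w =
  (tmom t.+1 w - tgrad t w) + (tgrad t w - tgrad t.+1 w).
Proof. by rewrite addrA subrK. Qed.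

Let one_step_drift t w :
  psqnorm (tgrad t w - tgrad t.+1 w) <= L ^+ 2 * psqnorm (titer t.+1 w - titer t w).
Proof. by rewrite -psqnormN opprB psqnorm_gradf_le. Qed.

Let adapted_gap t : adapted t.+1 (fun w => (1 - beta) *: (tmom t.+1 w - tgrad t.+1 w)).
Proof.
by move=> b; apply/measurable_paramZ/measurable_paramB; [exact: adapted_tmom|exact: adapted_tgrad].
Qed.

Let rintegrable_gap t :
  rintegrable P (fun w => psqnorm ((1 - beta) *: (tmom t.+1 w - tgrad t.+1 w))).
Proof.
apply/rintegrable_psqnormZ/rintegrable_psqnormB.
- exact: measurable_tmom.
- exact: measurable_tgrad.
- exact: rintegrable_tmom.
- exact: rintegrable_tgrad.
Qed.

(** Valid at every iteration but meant for refreshes: the new projection depends on the fresh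
    samples and is dropped first. The unprojected old gap then splits into its error and its
    complement. *)
Lemma exp_err_refresh t : exp_err t.+1 <=
  (1 - beta) * (exp_err t + exp_compl t) + (beta^-1 * L ^+ 2) * exp_move t
    + beta ^+ 2 * sigma2.
Proof.
have /andP[b0 b1] := beta_itv.
have [Hi Hle] := sgrad_noise beta (@adapted_gap t) (@rintegrable_gap t).
apply: (@le_trans _ _ (\int[P]_w psqnorm ((1 - beta) *: (tmom t.+1 w - tgrad t.+1 w) +
    beta *: (tsgrad t.+1 w - tgrad t.+1 w)))).
  apply: Rexp_le; [exact: rintegrable_err|exact: Hi|] => w.
  by rewrite tproj_err orthoproj_le//; exact: tproj_orthoproj.
apply: (le_trans Hle); rewrite lerD2r -RexpD; [|exact: rintegrable_err|exact: rintegrable_compl].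
have i1 : rintegrable P (fun w => psqnorm (tproj t.+1 w (tmom t.+1 w - tgrad t w)) +
    psqnorm (tgrad t w - tproj t.+1 w (tgrad t w))).
  by apply: rintegrableD; [exact: rintegrable_err|exact: rintegrable_compl].
rewrite -!RexpZ//; last exact: rintegrable_move.
rewrite -RexpD; [|exact: rintegrableZ|exact/rintegrableZ/rintegrable_move].
apply: Rexp_le; first exact: rintegrable_gap.
  by apply: rintegrableD; [exact: rintegrableZ|exact/rintegrableZ/rintegrable_move].
move=> w; rewrite mom_gap_split; apply: (le_trans (momentum_young _ _)).
have oPi := tproj_orthoproj t w; have [_ _ idem] := oPi.
rewrite (orthoproj_split oPi (tgrad t w)); last by rewrite tmom_step idem.
rewrite lerD2l -mulrA ler_wpM2l ?invr_ge0 ?(ltW b0)//; exact: one_step_drift.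
Qed.

(** The projection is inherited and known beforehand, so it stays in place and only the projected
    part of the old gap survives. *)
Lemma exp_err_lazy t : (t.+1 %% tau != 0)%N -> exp_err t.+1 <=
  (1 - beta) * exp_err t + (beta^-1 * L ^+ 2) * exp_move t + beta ^+ 2 * sigma2.
Proof.
move=> tn; have /andP[b0 b1] := beta_itv.
have projE w : tproj t.+2 w = tproj t.+1 w by exact: gproj_lazy.
have mgap := measurable_paramZ (1 - beta)
  (measurable_paramB (@measurable_tmom t.+1) (@measurable_tgrad t.+1)).
have i0 := rintegrable_tproj t mgap (@rintegrable_gap t).
have := lazy_noise_proj beta tn (@adapted_gap t) i0.
rewrite /exp_err; under [X in _ -> X <= _]eq_Rintegral do rewrite tproj_err projE.
move=> Hle; apply: (le_trans Hle); rewrite lerD2r.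
rewrite -!RexpZ//; [|exact: rintegrable_move|exact: rintegrable_err].
rewrite -RexpD; [|exact/rintegrableZ/rintegrable_err|exact/rintegrableZ/rintegrable_move].
apply: Rexp_le; first exact: i0.
  by apply: rintegrableD; apply: rintegrableZ; [exact: rintegrable_err|exact: rintegrable_move].
have oPi w := tproj_orthoproj t w.
move=> w; rewrite mom_gap_split (orthoprojZ (oPi w)) (orthoprojD (oPi w)).
apply: (le_trans (momentum_young _ _)).
rewrite lerD2l -mulrA ler_wpM2l ?invr_ge0 ?(ltW b0)//.
by apply: (le_trans (orthoproj_le (oPi w) _)); exact: one_step_drift.
Qed.

Lemma exp_err_init : exp_err 0 <= psqnorm (gradf x0) + beta ^+ 2 * sigma2.
Proof.
have /andP[b0 b1] := beta_itv.
pose Y w := (1 - beta) *: (tmom 0 w - tgrad 0 w).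
have aY : adapted 0 Y.
  by move=> b; apply/measurable_paramZ/measurable_paramB;
    [exact: adapted_tmom|exact: adapted_tgrad].
have iY : rintegrable P (fun w => psqnorm (Y w)).
  apply/rintegrable_psqnormZ/rintegrable_psqnormB; [exact: measurable_tmom|
    exact: measurable_tgrad|exact: rintegrable_tmom|exact: rintegrable_tgrad].
have [Hi Hle] := sgrad_noise beta aY iY.
apply: (@le_trans _ _ (\int[P]_w psqnorm (Y w + beta *: (tsgrad 0 w - tgrad 0 w)))).
  apply: Rexp_le; [exact: rintegrable_err|exact: Hi|] => w.
  by rewrite tproj_err orthoproj_le//; exact: tproj_orthoproj.
apply: (le_trans Hle); rewrite lerD2r -[leRHS](Rexp_cst P).
apply: Rexp_le => // [|w]; first exact: rintegrable_cst.
rewrite /Y psqnormZ /tmom gmom_init sub0r psqnormN /=.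
have c1 : (1 - beta) ^+ 2 <= 1 by rewrite expr_le1 ?subr_ge0// gerBl ltW.
by rewrite -[leRHS]mul1r ler_wpM2r ?psqnorm_ge0.
Qed.

Lemma tproj_since_refresh (k t : nat) w : (k <= t)%N ->
  (forall s, (k < s <= t)%N -> (s %% tau != 0)%N) -> tproj t.+1 w = tproj k.+1 w.
Proof.
elim: t => [|t IH]; first by rewrite leqn0 => /eqP ->.
rewrite leq_eqVlt => /predU1P[->//|kt] lazy.
rewrite -IH//; last by move=> s /andP[ks st]; apply: lazy; rewrite ks ltnW.
by apply: gproj_lazy; apply: lazy; rewrite ltnS in kt *; rewrite kt leqnn.
Qed.

Lemma exp_sgrad_var k : (k %% tau == 0)%N ->
  rintegrable P (fun w => psqnorm (tsgrad k w - tgrad k w)) /\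
  \int[P]_w psqnorm (tsgrad k w - tgrad k w) <= sigma2 / Bsz%:R.
Proof.
move=> k0.
have a0 : adapted k (fun=> 0) by move=> b; exact: measurable_param_cst.
have i0 : rintegrable P (fun w => psqnorm ((fun=> 0 : V) w)) by exact: rintegrable_cst.
have [] := refresh_noise 1 k0 a0 i0.
under eq_Rintegral do rewrite add0r scale1r.
rewrite (_ : (fun w => psqnorm (0 + 1 *: (tsgrad k w - tgrad k w))) =
  (fun w => psqnorm (tsgrad k w - tgrad k w))); last first.
  by apply/funext => w; rewrite add0r scale1r.
move=> Hi Hle; split => //; apply: (le_trans Hle).
by rewrite (Rexp_cst P (psqnorm (0 : V))) psqnorm0 add0r expr1n mul1r.
Qed.

(** The singular vectors are adapted to the batch gradient at [k]; the same projection is tested on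
    the true gradient at [t]. Their distance consists of the drift since [k] and the batch noise. *)
Lemma exp_compl_le (k t : nat) : (k <= t)%N -> (k %% tau == 0)%N ->
  (forall s, (k < s <= t)%N -> (s %% tau != 0)%N) ->
  exp_compl t <= (1 - dl / 2) * exp_grad t +
    20 / dl * (L ^+ 2 * ((t - k)%:R * \sum_(k <= s < t) exp_move s) + sigma2 / Bsz%:R).
Proof.
move=> kt k0 lazy; have /andP[dl0 dl1] := dl_itv.
have [i1 le1] := exp_drift_le kt; have [i2 le2] := exp_sgrad_var k0.
apply: (@le_trans _ _ ((1 - dl / 2) * exp_grad t + 20 / dl *
   (\int[P]_w psqnorm (tgrad t w - tgrad k w) + \int[P]_w psqnorm (tsgrad k w - tgrad k w)))).
  rewrite -RexpD// -!RexpZ; [|exact: rintegrableD|exact: rintegrable_tgrad].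
  have i3 : rintegrable P (fun w => 20 / dl * (psqnorm (tgrad t w - tgrad k w) +
    psqnorm (tsgrad k w - tgrad k w))) by exact/rintegrableZ/rintegrableD.
  rewrite -RexpD//; last exact/rintegrableZ/rintegrable_tgrad.
  apply: Rexp_le; first exact: rintegrable_compl.
    by apply: rintegrableD => //; exact/rintegrableZ/rintegrable_tgrad.
  move=> w; rewrite (tproj_since_refresh _ kt lazy).
  have oPi := tproj_orthoproj k w.
  have contr : psqnorm (tsgrad k w - tproj k.+1 w (tsgrad k w))
      <= (1 - dl) * psqnorm (tsgrad k w) by exact: gproj_refresh_le.
  apply: (le_trans (orthoproj_compl_transfer oPi _ dl_itv contr)).
  (* The extra factor 2 pays for separating drift from batch noise. *)
  rewrite lerD2l; have -> : 20 / dl = 10 / dl * 2 by field; rewrite gt_eqF.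
  rewrite -(mulrA (10 / dl) 2) ler_wpM2l ?divr_ge0 ?(ltW dl0)// mulrDr.
  rewrite -[X in _ <= _ + 2 * X]psqnormN opprB.
  rewrite (_ : tgrad t w - tsgrad k w = (tgrad t w - tgrad k w) + (tgrad k w - tsgrad k w)).
    exact: psqnormD_le.
  by rewrite addrA subrK.
by rewrite lerD2l ler_wpM2l ?divr_ge0 ?(ltW dl0)// lerD.
Qed.

(** The inner product of gradient and momentum is polarized, which produces the gap between them;
    that gap is then split by the projection. *)
Lemma descent_step t w :
  f (titer t.+1 w) + ((2 * eta)^-1 - L / 2) * psqnorm (titer t.+1 w - titer t w)
    + eta / 2 * psqnorm (tgrad t w) <=
  f (titer t w) + eta / 2 * (psqnorm (tproj t.+1 w (tmom t.+1 w - tgrad t w)) +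
    psqnorm (tgrad t w - tproj t.+1 w (tgrad t w))).
Proof.
have oPi := tproj_orthoproj t w; have [_ _ idem] := oPi.
rewrite -(orthoproj_split oPi (tgrad t w)); last by rewrite tmom_step idem.
have := descent_lemma f_grad gradf_lip (titer t w) (titer t.+1 w - titer t w).
rewrite addrC subrK titer_moveE !psqnormN psqnormZ pinnerNr pinnerZr psqnormB.
rewrite -/(tgrad t w) (pinnerC (tmom t.+1 w)).
set a := psqnorm (tmom _ _); set b := psqnorm (tgrad t w); set p := pinner _ _.
have -> : ((2 * eta)^-1 - L / 2) * (eta ^+ 2 * a) = eta / 2 * a - L / 2 * (eta ^+ 2 * a).
  by field; rewrite gt_eqF.
lra.
Qed.

Lemma descent_sum (c : R) T w : (forall y, c <= f y) ->
  \sum_(0 <= t < T) (((2 * eta)^-1 - L / 2) * psqnorm (titer t.+1 w - titer t w) +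
    eta / 2 * psqnorm (tgrad t w)) <=
  (f x0 - c) + \sum_(0 <= t < T) (eta / 2 *
    (psqnorm (tproj t.+1 w (tmom t.+1 w - tgrad t w)) +
     psqnorm (tgrad t w - tproj t.+1 w (tgrad t w)))).
Proof.
move=> cf; suff H : f (titer T w) + \sum_(0 <= t < T)
    (((2 * eta)^-1 - L / 2) * psqnorm (titer t.+1 w - titer t w) +
    eta / 2 * psqnorm (tgrad t w)) <=
  f x0 + \sum_(0 <= t < T) (eta / 2 *
    (psqnorm (tproj t.+1 w (tmom t.+1 w - tgrad t w)) +
     psqnorm (tgrad t w - tproj t.+1 w (tgrad t w)))).
  by have := cf (titer T w); lra.
elim: T => [|T IH]; first by rewrite !big_geq// !addr0.
rewrite !big_nat_recr//=; have := descent_step T w; lra.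
Qed.

Lemma exp_descent (c : R) T : (forall y, c <= f y) ->
  ((2 * eta)^-1 - L / 2) * (\sum_(0 <= t < T) exp_move t) +
    eta / 2 * (\sum_(0 <= t < T) exp_grad t) <=
  (f x0 - c) + eta / 2 * (\sum_(0 <= t < T) (exp_err t + exp_compl t)).
Proof.
move=> cf.
have i1 t : rintegrable P (fun w => ((2 * eta)^-1 - L / 2) *
    psqnorm (titer t.+1 w - titer t w) + eta / 2 * psqnorm (tgrad t w)).
  by apply: rintegrableD; apply: rintegrableZ; [exact: rintegrable_move|exact: rintegrable_tgrad].
have i2 t : rintegrable P (fun w => psqnorm (tproj t.+1 w (tmom t.+1 w - tgrad t w)) +
     psqnorm (tgrad t w - tproj t.+1 w (tgrad t w))).
  by apply: rintegrableD; [exact: rintegrable_err|exact: rintegrable_compl].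
have i3 : rintegrable P (fun w => \sum_(0 <= t < T) (eta / 2 *
    (psqnorm (tproj t.+1 w (tmom t.+1 w - tgrad t w)) +
     psqnorm (tgrad t w - tproj t.+1 w (tgrad t w))))).
  by apply: rintegrable_sum => t; exact: rintegrableZ.
have E1 t : \int[P]_w (((2 * eta)^-1 - L / 2) * psqnorm (titer t.+1 w - titer t w) +
    eta / 2 * psqnorm (tgrad t w)) = ((2 * eta)^-1 - L / 2) * exp_move t + eta / 2 * exp_grad t.
  rewrite RexpD; [|exact/rintegrableZ/rintegrable_move|exact/rintegrableZ/rintegrable_tgrad].
  by rewrite !RexpZ//; [exact: rintegrable_move|exact: rintegrable_tgrad].
have E2 t : \int[P]_w (eta / 2 * (psqnorm (tproj t.+1 w (tmom t.+1 w - tgrad t w)) +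
     psqnorm (tgrad t w - tproj t.+1 w (tgrad t w)))) = eta / 2 * (exp_err t + exp_compl t).
  by rewrite RexpZ// RexpD//; [exact: rintegrable_err|exact: rintegrable_compl].
have := Rexp_le (rintegrable_sum _ i1) (rintegrableD (rintegrable_cst P (f x0 - c)) i3)
  (fun w => descent_sum T w cf).
rewrite Rexp_sum// RexpD//; last exact: rintegrable_cst.
rewrite Rexp_cst Rexp_sum; last by move=> t; exact: rintegrableZ.
rewrite !mulr_sumr -big_split /=.
by under eq_bigr do rewrite E1; under [X in _ <= _ + X -> _]eq_bigr do rewrite E2.
Qed.
End Trajectory.

(** * Sums over windows and blocks of indices *)

Section WindowSums.
Context (R : realType).
Implicit Types (D W : nat -> R) (t k T tau : nat).

(** Delay by one, padded with 0; truncated subtraction in the index would repeat [D 0] instead. *)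
Definition shift D : nat -> R := fun t => if t is s.+1 then D s else 0.

Lemma iter_shift_ge0 D j t : (forall s, 0 <= D s) -> 0 <= iter j shift D t.
Proof. by move=> D0; elim: j t => [|j IH] [|t] //=. Qed.

Lemma sum_iter_shift_le D j T : (forall s, 0 <= D s) ->
  \sum_(0 <= t < T) iter j shift D t <= \sum_(0 <= t < T) D t.
Proof.
move=> D0; elim: j => [//|j IH]; apply: le_trans IH; rewrite iterS.
set F := iter j shift D; have F0 s : 0 <= F s by exact: iter_shift_ge0.
case: T => [|T]; first by rewrite !big_geq.
by rewrite big_nat_recl//= add0r [leRHS]big_nat_recr//= lerDl.
Qed.

Lemma window_le_shift D k t tau : (forall s, 0 <= D s) -> (t - k <= tau)%N ->
  \sum_(k <= s < t) D s <= \sum_(j < tau) iter j.+1 shift D t.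
Proof.
move=> D0; elim: tau t => [|tau IH] t.
  by rewrite leqn0 subn_eq0 => tk; rewrite big_geq// big_ord0.
case: t => [|t] tk.
  by rewrite big_geq//; apply: sumr_ge0 => j _; exact: iter_shift_ge0.
have [kt|kt] := leqP k t.
  rewrite big_nat_recr//= addrC big_ord_recl lerD2l; apply: IH.
  by rewrite subSn// ltnS in tk.
by rewrite big_geq//; apply: sumr_ge0 => j _; exact: iter_shift_ge0.
Qed.

(** Each window lies below [tau] delayed copies of [D], and a delay does not increase partial
    sums. *)
Lemma sum_windows_le D (k : nat -> nat) T tau : (forall s, 0 <= D s) ->
  (forall t, (t - k t <= tau)%N) ->
  \sum_(0 <= t < T) \sum_(k t <= s < t) D s <= tau%:R * \sum_(0 <= t < T) D t.
Proof.
move=> D0 kt.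
apply: (@le_trans _ _ (\sum_(0 <= t < T) \sum_(j < tau) iter j.+1 shift D t)).
  by apply: ler_sum => t _; exact: window_le_shift.
rewrite exchange_big /= -[tau in tau%:R]card_ord mulr_natl -sumr_const.
by apply: ler_sum => j _; exact: (sum_iter_shift_le j.+1 T D0).
Qed.

(** The complete blocks are disjoint and tile the range up to the last multiple of [tau]. *)
Lemma sum_blocks_le W tau T : (0 < tau)%N -> (forall s, 0 <= W s) ->
  \sum_(0 <= t < T) (if (tau %| t.+1)%N then \sum_(t.+1 - tau <= s < t.+1) W s else 0)
    <= \sum_(0 <= t < T) W t.
Proof.
move=> tau0 W0.
apply: (@le_trans _ _ (\sum_(0 <= s < (T %/ tau) * tau) W s)); last first.
  rewrite [leRHS](@big_cat_nat _ _ _ (T %/ tau * tau)) ?leq_divM//= lerDl.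
  by apply: sumr_ge0.
elim: T => [|T IH]; first by rewrite big_geq// div0n big_geq.
rewrite big_nat_recr//= divnS//; case: ifP => [dv|_]; last by rewrite addr0 add0n.
have E : (T.+1 = (true + T %/ tau) * tau)%N by rewrite -[in RHS]dv -divnS// divnK.
rewrite -E [leRHS](@big_cat_nat _ _ _ (T.+1 - tau)) ?leq_subr//= lerD2r.
by rewrite E mulnDl mul1n addKn.
Qed.
End WindowSums.

(** * Summing the recursions, for abstract real sequences *)

Section Summation.
Context (R : realType) (U D E H : nat -> R) (L beta dl eta G0 s2 B Dlt : R) (tau : nat).
Hypotheses (U0 : forall t, 0 <= U t) (D0 : forall t, 0 <= D t) (E0 : forall t, 0 <= E t).
Hypotheses (L0 : 0 < L) (beta_itv : 0 < beta <= 1) (dl_itv : 0 < dl <= 1) (eta0 : 0 < eta).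
Hypotheses (s20 : 0 <= s2) (B0 : 0 < B) (tau0 : (0 < tau)%N).
Hypothesis E_init : E 0 <= G0 + beta ^+ 2 * s2.
Hypothesis E_refresh : forall t, E t.+1 <=
  (1 - beta) * (E t + H t) + (beta^-1 * L ^+ 2) * D t + beta ^+ 2 * s2.
Hypothesis E_lazy : forall t, (t.+1 %% tau != 0)%N ->
  E t.+1 <= (1 - beta) * E t + (beta^-1 * L ^+ 2) * D t + beta ^+ 2 * s2.
Hypothesis H_le_U : forall t, H t <= U t.
Hypothesis H_le : forall k t, (k <= t)%N -> (k %% tau == 0)%N ->
  (forall s, (k < s <= t)%N -> (s %% tau != 0)%N) ->
  H t <= (1 - dl / 2) * U t +
    20 / dl * (L ^+ 2 * ((t - k)%:R * \sum_(k <= s < t) D s) + s2 / B).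
Hypothesis U_drift : forall k t, (k <= t)%N ->
  U t <= 2 * U k + 2 * (L ^+ 2 * ((t - k)%:R * \sum_(k <= s < t) D s)).
Hypothesis descent : forall T,
  ((2 * eta)^-1 - L / 2) * (\sum_(0 <= t < T) D t) + eta / 2 * (\sum_(0 <= t < T) U t) <=
  Dlt + eta / 2 * (\sum_(0 <= t < T) (E t + H t)).
Hypothesis G0_le : G0 <= 2 * L * Dlt.
Hypothesis tau_ge : 64 / (3 * dl * beta) <= tau%:R.
Hypothesis B_ge : 1 / (dl * beta) <= B.
Hypothesis eta_le :
  eta / 2 * ((20 / dl * tau%:R ^+ 2 + 2 * tau%:R / beta + beta^-1 ^+ 2) * L ^+ 2)
    <= (2 * eta)^-1 - L / 2.

Local Notation SU T := (\sum_(0 <= t < T) U t).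
Local Notation SD T := (\sum_(0 <= t < T) D t).

Let b0 : 0 < beta. Proof. by case/andP: beta_itv. Qed.
Let b1 : beta <= 1. Proof. by case/andP: beta_itv. Qed.
Let dl0 : 0 < dl. Proof. by case/andP: dl_itv. Qed.
Let dl1 : dl <= 1. Proof. by case/andP: dl_itv. Qed.
Let tauR0 : 0 < tau%:R :> R. Proof. by rewrite ltr0n. Qed.

(** Apply the bound from the last refresh before or at [t]. One factor [tau] comes from the elapsed
    time, the other from how often each move is counted. *)
Lemma sum_compl_le T : \sum_(0 <= t < T) H t <=
  (1 - dl / 2) * SU T + 20 / dl * (L ^+ 2 * (tau%:R ^+ 2 * SD T) + T%:R * (s2 / B)).
Proof.
pose k t := ((t %/ tau) * tau)%N.
have kE t : (t - k t = t %% tau)%N by rewrite {1}(divn_eq t tau) addKn.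
have kt t : (k t <= t)%N by exact: leq_divM.
have mod_le t : (t - k t <= tau)%N by rewrite kE ltnW// ltn_pmod.
have W0 t : 0 <= \sum_(k t <= s < t) D s by apply: sumr_ge0.
have Hle t : H t <= (1 - dl / 2) * U t +
    20 / dl * (L ^+ 2 * (tau%:R * \sum_(k t <= s < t) D s) + s2 / B).
  have lazy s : (k t < s <= t)%N -> (s %% tau != 0)%N.
    move=> /andP[ks st]; apply/negP => /eqP s0.
    have sE : s = (s %/ tau * tau)%N by rewrite {1}(divn_eq s tau) s0 addn0.
    have : (s %/ tau <= t %/ tau)%N by exact: leq_div2r.
    by apply/negP; rewrite -ltnNge -(ltn_pmul2r tau0) -sE.
  apply: (le_trans (H_le (kt t) _ lazy)); first by rewrite modnMl.
  rewrite lerD2l ler_wpM2l ?divr_ge0 ?(ltW dl0)// lerD2r ler_wpM2l ?sqr_ge0//.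
  by rewrite ler_wpM2r ?ler_nat.
apply: (le_trans (ler_sum _ (fun t _ => Hle t))).
rewrite big_split /= -!mulr_sumr lerD2l ler_wpM2l ?divr_ge0 ?(ltW dl0)//.
rewrite big_split /= -!mulr_sumr sumr_const_nat subn0 -[_ *+ T]mulr_natl [s2 * _]mulrCA lerD2r.
rewrite ler_wpM2l ?sqr_ge0// expr2 -mulrA ler_wpM2l ?(ltW tauR0)//.
exact: sum_windows_le.
Qed.

(** Weights for averaging [U_drift] over a block of length [tau]: each gradient gets a share 1 /
    [tau], so a refresh costs little. *)
Let W s : R := 2 / tau%:R * U s + 2 * L ^+ 2 * tau%:R * D s.

Let W0 s : 0 <= W s.
Proof.
by rewrite addr_ge0// ?mulr_ge0 ?invr_ge0 ?sqr_ge0// ltW.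
Qed.

(* A refresh ends a complete block, over which the last gradient is averaged. *)
Lemma block_end_le t : (tau %| t.+1)%N -> H t <= \sum_(t.+1 - tau <= s < t.+1) W s.
Proof.
move=> dv; apply: (le_trans (H_le_U t)).
have tt : (tau <= t.+1)%N by exact: dvdn_leq.
set a := (t.+1 - tau)%N.
have ta : (t.+1 - a = tau)%N by rewrite /a subKn.
rewrite big_split /= -!mulr_sumr.
set SUb := \sum_(a <= s < t.+1) U s; set SDb := \sum_(a <= s < t.+1) D s.
have key : tau%:R * U t <= 2 * SUb + tau%:R * (2 * L ^+ 2 * tau%:R * SDb).
  have -> : tau%:R * U t = \sum_(a <= s < t.+1) U t.
    by rewrite sumr_const_nat ta mulr_natl.
  have -> : 2 * SUb + tau%:R * (2 * L ^+ 2 * tau%:R * SDb) =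
      \sum_(a <= s < t.+1) (2 * U s + 2 * L ^+ 2 * tau%:R * SDb).
    by rewrite big_split /= -mulr_sumr; congr (_ + _); rewrite sumr_const_nat ta mulr_natl.
  rewrite big_nat [leRHS]big_nat; apply: ler_sum => s /andP[as_ st].
  have st' : (s <= t)%N by [].
  apply: (le_trans (U_drift st')); rewrite lerD2l.
  have -> : 2 * L ^+ 2 * tau%:R * SDb = 2 * (L ^+ 2 * (tau%:R * SDb)) by rewrite !mulrA.
  rewrite ler_wpM2l// ler_wpM2l ?sqr_ge0//; apply: ler_pM => //.
  - by apply: sumr_ge0.
  - by rewrite ler_nat -ta; apply: leq_sub; rewrite ?leqnSn.
  - rewrite /SDb (big_cat_nat as_ (ltnW st)) /=.
    rewrite [X in _ <= _ + X]big_nat_recr//= addrCA lerDl.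
    by rewrite addr_ge0// sumr_ge0.
rewrite -(ler_pM2l tauR0); apply: (le_trans key); rewrite mulrDr lerD2r.
by rewrite mulrA mulrCA divff ?gt_eqF// mulr1.
Qed.

(** Telescoping: each step loses [beta * E t], and the complement added at a refresh is charged to
    the block just ended. *)
Lemma sum_err_le T : (0 < T)%N -> beta * \sum_(0 <= t < T) E t <=
  G0 + 2 / tau%:R * SU T + (2 * L ^+ 2 * tau%:R + beta^-1 * L ^+ 2) * SD T
    + T%:R * (beta ^+ 2 * s2).
Proof.
pose Hb t := if (tau %| t.+1)%N then \sum_(t.+1 - tau <= s < t.+1) W s else 0.
have Hb0 t : 0 <= Hb t by rewrite /Hb; case: ifP => // _; exact: sumr_ge0.
have step t : E t.+1 <= (1 - beta) * E t + Hb t + (beta^-1 * L ^+ 2) * D t + beta ^+ 2 * s2.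
  rewrite /Hb; case: ifP => dv; last first.
    by rewrite addr0; apply: E_lazy; rewrite -/(dvdn tau t.+1) dv.
  apply: (le_trans (E_refresh t)); rewrite !lerD2r mulrDr lerD2l.
  have h := block_end_le dv; set Y := \sum_(_ <= s < _) W s in h *.
  have Y0 : 0 <= Y by exact: sumr_ge0.
  apply: (le_trans (ler_wpM2l _ h)); first by rewrite subr_ge0.
  by rewrite ler_piMl// gerBl ltW.
have pot T' : E T' + beta * \sum_(0 <= t < T') E t <= G0 + beta ^+ 2 * s2 +
    \sum_(0 <= t < T') (Hb t + (beta^-1 * L ^+ 2) * D t + beta ^+ 2 * s2).
  elim: T' => [|T' IH]; first by rewrite !big_geq// mulr0 !addr0.
  by rewrite !big_nat_recr//=; have := step T'; lra.
case: T => [//|T] _; rewrite big_nat_recr//= mulrDr.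
have pT := pot T; rewrite !big_split /= -mulr_sumr sumr_const_nat subn0 in pT.
(* The final value kept by the telescoped bound supplies the last term of the sum. *)
have bE : beta * E T <= E T by rewrite ler_piMl.
have hb : \sum_(0 <= t < T) Hb t <= \sum_(0 <= t < T) W t by exact: sum_blocks_le.
have hW : \sum_(0 <= t < T) W t <= \sum_(0 <= t < T.+1) W t.
  by rewrite [leRHS]big_nat_recr//= lerDl.
have hD : SD T <= SD T.+1 by rewrite [leRHS]big_nat_recr//= lerDl.
have eW : \sum_(0 <= t < T.+1) W t = 2 / tau%:R * SU T.+1 + 2 * L ^+ 2 * tau%:R * SD T.+1.
  by rewrite big_split /= -!mulr_sumr.
have c0 : 0 <= beta^-1 * L ^+ 2 by rewrite mulr_ge0 ?sqr_ge0// invr_ge0 ltW.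
have hD' := ler_wpM2l c0 hD.
rewrite -[_ *+ T]mulr_natl in pT; rewrite -natr1 mulrDl mul1r.
rewrite (mulrDl (2 * L ^+ 2 * tau%:R)).
lra.
Qed.

(** The complement leaves dl / 2 of the gradients, and the refreshes take back 3 dl / 32 because of
    the length of [tau]: 1/2 - 3/32 = 13/32. The noise constant 21 is 1 from the momentum and 20
    from the batches. *)
Lemma summation_bound T : (0 < T)%N ->
  13 / 32 * dl * SU T <= 2 * (Dlt / eta) + 21 * (T%:R * (beta * s2)) + 2 * L * Dlt / beta.
Proof.
move=> T0.
have hE := sum_err_le T0; have hH := sum_compl_le T.
have hd := descent T.
rewrite big_split /= in hd.
set sU := SU T in hE hH hd *; set sD := SD T in hE hH hd.
set sE := \sum_(0 <= t < T) E t in hE hd; set sH := \sum_(0 <= t < T) H t in hH hd.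
have sU0 : 0 <= sU by apply: sumr_ge0.
have sD0 : 0 <= sD by apply: sumr_ge0.
have bi0 : 0 < beta^-1 by rewrite invr_gt0.
have hE' : sE <= beta^-1 * (2 * L * Dlt) + 3 / 32 * dl * sU +
    (2 * tau%:R / beta + beta^-1 ^+ 2) * L ^+ 2 * sD + T%:R * (beta * s2).
  have t1 : beta^-1 * (2 / tau%:R) <= 3 / 32 * dl.
    rewrite mulrA ler_pdivrMr// ler_pdivrMl//.
    have := ler_wpM2l (ltW (mulr_gt0 b0 dl0)) tau_ge.
    have -> : beta * dl * (64 / (3 * dl * beta)) = 64 / 3.
      by field; rewrite ?gt_eqF.
    lra.
  have t2 := ler_wpM2r sU0 t1.
  have t3 := ler_wpM2l (ltW bi0) hE.
  have t4 := ler_wpM2l (ltW bi0) G0_le.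
  rewrite mulKf ?gt_eqF// in t3.
  apply: (le_trans t3).
  have -> : beta^-1 * (G0 + 2 / tau%:R * sU + (2 * L ^+ 2 * tau%:R + beta^-1 * L ^+ 2) * sD +
      T%:R * (beta ^+ 2 * s2)) = beta^-1 * G0 + beta^-1 * (2 / tau%:R) * sU +
      (2 * tau%:R / beta + beta^-1 ^+ 2) * L ^+ 2 * sD + T%:R * (beta * s2).
    by field; rewrite !gt_eqF.
  lra.
have hH' : sH <= (1 - dl / 2) * sU + 20 / dl * tau%:R ^+ 2 * L ^+ 2 * sD +
    20 * (T%:R * (beta * s2)).
  have t1 : s2 / B <= dl * beta * s2.
    rewrite ler_pdivrMr//; have := ler_wpM2l (mulr_ge0 (ltW (mulr_gt0 dl0 b0)) s20) B_ge.
    have -> : dl * beta * s2 * (1 / (dl * beta)) = s2 by field; rewrite !gt_eqF.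
    by [].
  have t2 := ler_wpM2l (ler0n R T) t1.
  have c0 : 0 <= 20 / dl by rewrite divr_ge0// ltW.
  have t3 := ler_wpM2l c0 t2.
  have e3 : 20 / dl * (T%:R * (dl * beta * s2)) = 20 * (T%:R * (beta * s2)).
    by field; rewrite gt_eqF.
  rewrite e3 in t3; rewrite mulrDr in hH; lra.
(* The step size lets the descent term in [sD] absorb all drift. *)
have hK := ler_wpM2r sD0 eta_le.
have main : eta / 2 * (13 / 32 * dl * sU) <= Dlt + eta / 2 *
    (21 * (T%:R * (beta * s2)) + beta^-1 * (2 * L * Dlt)).
  have e0 : 0 <= eta / 2 by rewrite divr_ge0// ltW.
  have h1 := ler_wpM2l e0 (lerD hE' hH').
  lra.
have i0 : 0 <= 2 / eta by rewrite divr_ge0// ltW.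
have := ler_wpM2l i0 main; rewrite mulrDr !mulrA.
have -> : 2 / eta * eta / 2 = 1 by field; rewrite gt_eqF.
rewrite !mul1r; have -> : 2 / eta * Dlt = 2 * (Dlt / eta) by rewrite mulrAC mulrA.
rewrite !mulrA; lra.
Qed.
End Summation.

(** * The prescribed constants and the resulting rate *)

Section Constants.
Context (R : realType).
Implicit Types (x y L dl beta t eta : R).

Lemma sqrt_le_of_sqr x y : 0 <= y -> x <= y ^+ 2 -> Num.sqrt x <= y.
Proof. by move=> y0 xy; rewrite -(ger0_norm y0) -sqrtr_sqr ler_wsqrtr. Qed.

(** Turns the half-integer powers of [delta] into powers of its square root, where [ring] and
    [field] apply. *)
Lemma powR_half (n : nat) x : 0 <= x -> x `^ (n%:R / 2) = Num.sqrt x ^+ n.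
Proof.
by move=> x0; rewrite mulrC powRrM powR12_sqrt// powR_mulrn// sqrtr_ge0.
Qed.

(** With [A] the inverse step size the claim is [KK <= A * (A - L)]. Each square root in [A] was
    chosen so that its square dominates one drift term, and the summand 4 [L] absorbs the subtracted
    [L]. *)
Lemma stepsize_le L dl beta t : 0 < L -> 0 < dl <= 1 -> 0 < beta -> 0 <= t ->
  let eta := (4 * L + Num.sqrt (80 * L ^+ 2 / (3 * dl * beta ^+ 2))
           + Num.sqrt (40 * t ^+ 2 * L ^+ 2 / dl)
           + Num.sqrt (32 * t * L ^+ 2 / (3 * beta)))^-1 in
  0 < eta /\
  eta / 2 * ((20 / dl * t ^+ 2 + 2 * t / beta + beta^-1 ^+ 2) * L ^+ 2)
    <= (2 * eta)^-1 - L / 2.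
Proof.
move=> L0 /andP[dl0 dl1] b0 t0.
set a2 := 80 * L ^+ 2 / _; set b2 := 40 * t ^+ 2 * L ^+ 2 / dl; set c2 := 32 * t * L ^+ 2 / _.
set a := Num.sqrt a2; set b := Num.sqrt b2; set c := Num.sqrt c2.
have a20 : 0 <= a2 by rewrite !mulr_ge0 ?invr_ge0 ?mulr_ge0 ?sqr_ge0// ltW.
have b20 : 0 <= b2 by rewrite !mulr_ge0 ?invr_ge0 ?sqr_ge0// ltW.
have c20 : 0 <= c2 by rewrite !mulr_ge0 ?invr_ge0 ?mulr_ge0 ?sqr_ge0// ltW.
have aE : a ^+ 2 = a2 by rewrite sqr_sqrtr.
have bE : b ^+ 2 = b2 by rewrite sqr_sqrtr.
have cE : c ^+ 2 = c2 by rewrite sqr_sqrtr.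
have a0 : 0 <= a by exact: sqrtr_ge0.
have bb0 : 0 <= b by exact: sqrtr_ge0.
have c0 : 0 <= c by exact: sqrtr_ge0.
set A := 4 * L + a + b + c => eta.
have A0 : 0 < A by rewrite /A; lra.
split; first by rewrite invr_gt0.
have dli : 1 <= dl^-1 by rewrite invr_ge1// ?unitfE ?gt_eqF.
have K : (20 / dl * t ^+ 2 + 2 * t / beta + beta^-1 ^+ 2) * L ^+ 2 <= a2 + b2 + c2.
  have -> : a2 = 80 / 3 * (dl^-1 * (beta^-1 ^+ 2 * L ^+ 2)) by rewrite /a2; field; rewrite !gt_eqF.
  have -> : b2 = 40 * (t ^+ 2 * L ^+ 2 / dl) by rewrite /b2; field; rewrite !gt_eqF.
  have -> : c2 = 32 / 3 * (t * L ^+ 2 / beta) by rewrite /c2; field; rewrite !gt_eqF.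
  have x0 : 0 <= beta^-1 ^+ 2 * L ^+ 2 by rewrite mulr_ge0 ?sqr_ge0.
  have x1 : 0 <= t ^+ 2 * L ^+ 2 / dl by rewrite !mulr_ge0 ?invr_ge0 ?sqr_ge0// ltW.
  have x2 : 0 <= t * L ^+ 2 / beta by rewrite !mulr_ge0 ?invr_ge0 ?sqr_ge0// ltW.
  have x3 : beta^-1 ^+ 2 * L ^+ 2 <= dl^-1 * (beta^-1 ^+ 2 * L ^+ 2) by rewrite ler_peMl.
  have -> : (20 / dl * t ^+ 2 + 2 * t / beta + beta^-1 ^+ 2) * L ^+ 2 =
    20 * (t ^+ 2 * L ^+ 2 / dl) + 2 * (t * L ^+ 2 / beta) + beta^-1 ^+ 2 * L ^+ 2.
    by field; rewrite !gt_eqF.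
  lra.
set KK := (_ * L ^+ 2) in K *.
have key : KK <= A * (A - L).
  have p1 : 0 <= L * a by rewrite mulr_ge0// ltW.
  have p2 : 0 <= L * b by rewrite mulr_ge0// ltW.
  have p3 : 0 <= L * c by rewrite mulr_ge0// ltW.
  have p4 : 0 <= a * b by rewrite mulr_ge0.
  have p5 : 0 <= a * c by rewrite mulr_ge0.
  have p6 : 0 <= b * c by rewrite mulr_ge0.
  have p7 : 0 <= L * L by rewrite mulr_ge0// ltW.
  by apply: (le_trans K); rewrite -aE -bE -cE /A; lra.
have -> : (2 * eta)^-1 - L / 2 = A^-1 / 2 * (A * (A - L)).
  by rewrite /eta invfM invrK; field; rewrite gt_eqF.
by rewrite /eta ler_wpM2l// divr_ge0// invr_ge0 ltW.
Qed.

(** The dominant term is [L * t / s]: since [t] is of order 1 / (s^2 beta), it has order L / (s^3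
    beta), and the other terms are no larger. *)
Lemma inv_stepsize_le L (s : R) beta t : 0 < L -> 0 < s <= 1 -> 0 < beta <= 1 -> 0 <= t ->
  t <= 64 / (3 * s ^+ 2 * beta) + 1 ->
  4 * L + Num.sqrt (80 * L ^+ 2 / (3 * s ^+ 2 * beta ^+ 2))
    + Num.sqrt (40 * t ^+ 2 * L ^+ 2 / s ^+ 2)
    + Num.sqrt (32 * t * L ^+ 2 / (3 * beta))
  <= 200 * (L * (s^-1 ^+ 3 * beta^-1)).
Proof.
move=> L0 /andP[s0 s1] /andP[b0 b1] t0.
set u := s^-1; set v := beta^-1.
have u1 : 1 <= u by rewrite /u invr_ge1// ?unitfE ?gt_eqF.
have v1 : 1 <= v by rewrite /v invr_ge1// ?unitfE ?gt_eqF.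
have u0 : 0 <= u by exact: le_trans u1.
have v0 : 0 <= v by exact: le_trans v1.
have -> : 64 / (3 * s ^+ 2 * beta) = 64 / 3 * (u ^+ 2 * v) by rewrite /u /v; field; rewrite !gt_eqF.
have -> : 80 * L ^+ 2 / (3 * s ^+ 2 * beta ^+ 2) = 80 / 3 * (L * (u * v)) ^+ 2.
  by rewrite /u /v; field; rewrite !gt_eqF.
have -> : 40 * t ^+ 2 * L ^+ 2 / s ^+ 2 = 40 * (L * (u * t)) ^+ 2.
  by rewrite /u; field; rewrite !gt_eqF.
have -> : 32 * t * L ^+ 2 / (3 * beta) = 32 / 3 * (L ^+ 2 * (v * t)).
  by rewrite /v; field; rewrite !gt_eqF.
move=> tle.
set w := u ^+ 3 * v.
have u21 : 1 <= u ^+ 2 by rewrite exprn_ege1.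
have u2v1 : 1 <= u ^+ 2 * v by rewrite mulr_ege1.
have t1 : t <= 23 * (u ^+ 2 * v) by lra.
have wE : w = u ^+ 2 * (u * v) by rewrite /w; ring.
have uv0 : 0 <= u * v by rewrite mulr_ge0.
have uvw : u * v <= w by rewrite wE ler_peMl.
have w1 : 1 <= w by rewrite /w mulr_ege1// exprn_ege1.
have w0 : 0 <= w by exact: le_trans w1.
have Lw0 : 0 <= L * w by rewrite mulr_ge0// ltW.
have b4 : 4 * L <= 4 * (L * w) by rewrite ler_wpM2l// ler_peMr// ltW.
have Luv : L * (u * v) <= L * w by rewrite ler_wpM2l// ltW.
have ba : Num.sqrt (80 / 3 * (L * (u * v)) ^+ 2) <= 6 * (L * w).
  apply: sqrt_le_of_sqr; first by rewrite mulr_ge0.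
  have h : (L * (u * v)) ^+ 2 <= (L * w) ^+ 2.
    by rewrite ler_sqr ?nnegrE// mulr_ge0// ltW.
  have := sqr_ge0 (L * w); rewrite exprMn; lra.
have bb : Num.sqrt (40 * (L * (u * t)) ^+ 2) <= 146 * (L * w).
  apply: sqrt_le_of_sqr; first by rewrite mulr_ge0.
  have h : (L * (u * t)) ^+ 2 <= (23 * (L * w)) ^+ 2.
    rewrite ler_sqr ?nnegrE; [|by rewrite !mulr_ge0// ltW|by rewrite mulr_ge0].
    have -> : 23 * (L * w) = L * (u * (23 * (u ^+ 2 * v))) by rewrite /w; ring.
    by rewrite !ler_wpM2l// ltW.
  have := sqr_ge0 (L * w); rewrite !exprMn in h *; lra.
have bc : Num.sqrt (32 / 3 * (L ^+ 2 * (v * t))) <= 16 * (L * w).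
  apply: sqrt_le_of_sqr; first by rewrite mulr_ge0.
  have h : L ^+ 2 * (v * t) <= 23 * (L * (u * v)) ^+ 2.
    have -> : 23 * (L * (u * v)) ^+ 2 = L ^+ 2 * (v * (23 * (u ^+ 2 * v))) by ring.
    by rewrite ler_wpM2l ?sqr_ge0// ler_wpM2l.
  have h2 : (L * (u * v)) ^+ 2 <= (L * w) ^+ 2.
    by rewrite ler_sqr ?nnegrE// mulr_ge0// ltW.
  have := sqr_ge0 (L * w); rewrite [(16 * _) ^+ 2]exprMn; lra.
(* The four contributions are 4 + 6 + 146 + 16 = 172. *)
lra.
Qed.

(* With [u = s^-1], [v = 1 + q] and [q ^+ 2 = s ^+ 3 * s2 * T / (L * Dlt)], every term of the
   left-hand side is at most a multiple of [L * Dlt * u ^+ 5 * v]. *)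
Lemma final_rate L Dlt (s s2 T SU A : R) : 0 < L -> 0 < Dlt -> 0 < s <= 1 -> 0 <= s2 -> 0 < T ->
  let q := Num.sqrt (s ^+ 3 * s2 * T / (L * Dlt)) in
  let beta := (1 + q)^-1 in
  A <= 200 * (L * (s^-1 ^+ 3 * beta^-1)) ->
  13 / 32 * s ^+ 2 * SU <= 2 * (Dlt * A) + 21 * (T * (beta * s2)) + 2 * L * Dlt / beta ->
  T^-1 * SU <= 1100 * (L * Dlt / (s ^+ 5 * T) + Num.sqrt (L * Dlt * s2 / (s ^+ 7 * T))).
Proof.
move=> L0 Dlt0 /andP[s0 s1] s20 T0 q beta; rewrite /beta invrK.
set v := 1 + q; set u := s^-1 => hA hSU.
have q0 : 0 <= q by exact: sqrtr_ge0.
have v1 : 1 <= v by rewrite /v; lra.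
have v0 : 0 < v by lra.
have u1 : 1 <= u by rewrite /u invr_ge1// ?unitfE ?gt_eqF.
have u0 : 0 <= u by exact: le_trans u1.
have LD0 : 0 < L * Dlt by exact: mulr_gt0.
have qE : q ^+ 2 = s ^+ 3 * s2 * T / (L * Dlt).
  by rewrite sqr_sqrtr// !mulr_ge0 ?invr_ge0 ?exprn_ge0// ltW.
have s2T : s2 * T = q ^+ 2 * (L * Dlt) * u ^+ 3.
  by rewrite qE /u; field; rewrite !gt_eqF.
have -> : Num.sqrt (L * Dlt * s2 / (s ^+ 7 * T)) = L * Dlt * u ^+ 5 * q / T.
  have -> : L * Dlt * s2 / (s ^+ 7 * T) = (L * Dlt * u ^+ 5 * q / T) ^+ 2.
    have -> : L * Dlt * s2 / (s ^+ 7 * T) = L * Dlt * (s2 * T) * u ^+ 7 / T ^+ 2.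
      by rewrite /u; field; rewrite !gt_eqF.
    by rewrite s2T; field; rewrite gt_eqF.
  rewrite sqrtr_sqr ger0_norm// !mulr_ge0 ?exprn_ge0 ?invr_ge0//; exact: ltW.
have -> : L * Dlt / (s ^+ 5 * T) = L * Dlt * u ^+ 5 / T by rewrite /u; field; rewrite !gt_eqF.
have -> : 1100 * (L * Dlt * u ^+ 5 / T + L * Dlt * u ^+ 5 * q / T) =
    T^-1 * (1100 * (L * Dlt * u ^+ 5 * v)) by rewrite /v; field; rewrite gt_eqF.
rewrite ler_wpM2l ?invr_ge0 ?(ltW T0)//.
set M := L * Dlt * (u ^+ 3 * v).
have M0 : 0 <= M by rewrite !mulr_ge0 ?exprn_ge0// ltW.
have u31 : 1 <= u ^+ 3 by rewrite exprn_ege1.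
have h1 : 2 * (Dlt * A) <= 400 * M.
  have := ler_wpM2l (ltW Dlt0) hA; rewrite -/v /M; lra.
(* The choice of [beta] balances here: the noise equals q^2 / v times [L * Dlt * u ^+ 3], and
   [q <= v]. *)
have h2 : T * (v^-1 * s2) <= M.
  have -> : T * (v^-1 * s2) = v^-1 * (s2 * T) by ring.
  rewrite s2T ler_pdivrMl// /M.
  have -> : v * (L * Dlt * (u ^+ 3 * v)) = v ^+ 2 * (L * Dlt) * u ^+ 3 by ring.
  rewrite ler_wpM2r ?exprn_ge0// ler_wpM2r ?(ltW LD0)// ler_sqr ?nnegrE//; last exact: ltW.
  by rewrite /v; lra.
have h3 : 2 * L * Dlt * v <= 2 * M.
  have -> : 2 * L * Dlt * v = 2 * (L * Dlt * v) by ring.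
  have -> : 2 * M = 2 * (u ^+ 3 * (L * Dlt * v)) by rewrite /M; ring.
  by rewrite ler_wpM2l// ler_peMl// mulr_ge0// ltW.
(* The right-hand side totals 400 + 21 + 2 = 423 times [M]; dividing by 13/32 gives less than
   1042. *)
have h4 : s ^+ 2 * SU <= 1100 * M by lra.
have -> : 1100 * (L * Dlt * u ^+ 5 * v) = u ^+ 2 * (1100 * M) by rewrite /M; ring.
have -> : SU = u ^+ 2 * (s ^+ 2 * SU) by rewrite /u; field; rewrite gt_eqF.
by rewrite ler_wpM2l ?exprn_ge0.
Qed.
End Constants.

Lemma natr_ceil_bounds (R : realType) (k : nat) (x : R) : k%:Z = Num.ceil x ->
  x <= k%:R <= x + 1.
Proof.
move=> kx; have -> : k%:R = (Num.ceil x)%:~R :> R by rewrite -kx.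
have /andP[c1 c2] := ceil_itv x; rewrite c2 /=.
by rewrite intrD rmorphN /= in c1; lra.
Qed.

Unset Implicit Arguments.

Theorem theorem3 (R : realType) :
  exists C : R, 0 < C /\
  forall (NL : nat) (m n r : 'I_NL -> nat)
    (dX : measure_display) (Xi : measurableType dX) (D : probability Xi R)
    (dO : measure_display) (Omega : measurableType dO) (P : probability Omega R)
    (xi : nat * nat -> Omega -> Xi)
    (f : param R m n -> R) (gradf : param R m n -> param R m n)
    (F : param R m n -> Xi -> R) (gradF : param R m n -> Xi -> param R m n)
    (L : R) (sigma_l : 'I_NL -> R) (x0 : param R m n)
    (svdP : nat -> forall l : 'I_NL, 'M[R]_(m l, n l) -> 'M[R]_(m l, r l))
    (svdQ : nat -> forall l : 'I_NL, 'M[R]_(m l, n l) -> 'M[R]_(n l, r l))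
    (T tau Bsz : nat) (Delta delta sigma beta1 eta : R),
  (* layers and ranks *)
  (0 < NL)%N ->
  (forall l, 0 < r l < minn (m l) (n l))%N ->
  (* setting: f(x) = E_{xi ~ D} F(x; xi), with gradients grad f, grad F *)
  (forall x, D.-integrable setT (fun z => (F x z)%:E)) ->
  (forall x, (f x)%:E = (\int[D]_z (F x z)%:E)%E) ->
  is_gradient f gradf ->
  (forall z, is_gradient (F ^~ z) (gradF ^~ z)) ->
  (* joint measurability of (x, xi) |-> grad F(x; xi) *)
  (forall (d' : measure_display) (T' : measurableType d')
          (y : T' -> param R m n) (w : T' -> Xi),
      measurable_param y -> measurable_fun setT w ->
      measurable_param (fun u => gradF (y u) (w u))) ->
  (* Assumption 1 *)
  (exists c : R, forall x, c <= f x) ->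
  (* Assumption 2 *)
  0 < L -> lipschitz_grad gradf L ->
  (* Assumption 3 *)
  (forall x l i j, D.-integrable setT (fun z => (gradF x z l i j)%:E) /\
      (\int[D]_z (gradF x z l i j)%:E = (gradf x l i j)%:E)%E) ->
  (forall l, 0 <= sigma_l l) ->
  (forall x l, (\int[D]_z (frob_sq (gradF x z l - gradf x l))%:E
                  <= ((sigma_l l) ^+ 2)%:E)%E) ->
  (* i.i.d. samples xi^{(t,b)} ~ D on the probability space (Omega, P) *)
  iid_family P D xi ->
  (* the SVD step: (P, Q) = (U[:, :r], V[:, :r]) for an SVD G = U S V^T,
     chosen measurably *)
  (forall t l (G : 'M[R]_(m l, n l)), exists U S V, is_svd G U S V /\
      svdP t l G = firstcols (r l) U /\ svdQ t l G = firstcols (r l) V) ->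
  (forall t l (d' : measure_display) (T' : measurableType d')
          (y : T' -> 'M[R]_(m l, n l)),
      measurable_mx y ->
      measurable_mx (fun u => svdP t l (y u)) /\
      measurable_mx (fun u => svdQ t l (y u))) ->
  (* constants *)
  Delta = f x0 - inf (range f) -> 0 < Delta ->
  delta = \big[Order.min/1]_(l < NL) ((r l)%:R / (minn (m l) (n l))%:R) ->
  sigma = Num.sqrt (\sum_(l < NL) sigma_l l ^+ 2) ->
  2 + 128 / (3 * delta) + (128 * sigma) ^+ 2 / (9 * Num.sqrt delta * L * Delta)
    <= T%:R ->
  beta1 = (1 + Num.sqrt (delta `^ (3 / 2) * sigma ^+ 2 * T%:R / (L * Delta)))^-1 ->
  tau%:Z = Num.ceil (64 / (3 * delta * beta1)) ->
  Bsz%:Z = Num.ceil (1 / (delta * beta1)) ->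
  eta = (4 * L + Num.sqrt (80 * L ^+ 2 / (3 * delta * beta1 ^+ 2))
           + Num.sqrt (40 * tau%:R ^+ 2 * L ^+ 2 / delta)
           + Num.sqrt (32 * tau%:R * L ^+ 2 / (3 * beta1)))^-1 ->
  (* conclusion *)
  ((T%:R^-1)%:E * \sum_(t < T)
      \int[P]_w (psqnorm (gradf (galore_iter beta1 eta tau Bsz gradF svdP svdQ
                                  (fun t' b => xi (t', b) w) x0 t)))%:E
   <= (C * (L * Delta / (delta `^ (5 / 2) * T%:R)
            + Num.sqrt (L * Delta * sigma ^+ 2 / (delta `^ (7 / 2) * T%:R))))%:E)%E.
Proof.
exists 1100; split; first by rewrite ltr0n.
move=> NL m n r dX Xi D dO Omega P xi f gradf F gradF L sigma_l x0 svdP svdQ T tau Bsz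
  Delta delta sigma beta1 eta NL0 rank_lt _ _ f_grad _ mgradF [c0 fc0] L0 lip mean sig0 var iid
  svdPQ msvd DeltaE Delta0 deltaE sigmaE TE beta1E tauE BszE etaE.
have delta_le l : delta <= (r l)%:R / (minn (m l) (n l))%:R.
  by rewrite deltaE; exact: bigmin_le_cond.
have delta_itv : 0 < delta <= 1.
  (* The default value 1 of the minimum yields the upper bound; positivity is checked on the default
     and on each layer. *)
  rewrite deltaE bigmin_le_id andbT; apply: lt_bigmin => [|l _]; first exact: ltr01.
  have /andP[r0 rm] := rank_lt l.
  by rewrite divr_gt0 ?ltr0n// (leq_trans r0 (ltnW rm)).
have /andP[d0 d1] := delta_itv.
pose s := Num.sqrt delta.
have s_itv : 0 < s <= 1 by rewrite sqrtr_gt0 d0 -sqrtr1 ler_wsqrtr.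
have /andP[s0 s1] := s_itv.
have deltas : delta = s ^+ 2 by rewrite sqr_sqrtr// ltW.
have sig2 : \sum_(l < NL) sigma_l l ^+ 2 = sigma ^+ 2.
  by rewrite sigmaE sqr_sqrtr// sumr_ge0// => l _; exact: sqr_ge0.
have T0 : (0 < T)%N.
  rewrite -(ltr0n R); apply: lt_le_trans TE.
  have p1 : 0 < 128 / (3 * delta) by rewrite divr_gt0// mulr_gt0.
  have p2 : 0 <= (128 * sigma) ^+ 2 / (9 * Num.sqrt delta * L * Delta).
    by rewrite divr_ge0 ?sqr_ge0// !mulr_ge0 ?sqrtr_ge0// ltW.
  by rewrite ltr_wpDr// addr_gt0.
have T0R : 0 < T%:R :> R by rewrite ltr0n.
rewrite !(powR_half _ (ltW d0)) -/s in beta1E *.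
set q := Num.sqrt _ in beta1E.
have q0 : 0 <= q by exact: sqrtr_ge0.
have beta_itv : 0 < beta1 <= 1.
  by rewrite beta1E invr_gt0 invf_le1 ?ltr_pwDl// lerDl q0.
have /andP[b0 b1] := beta_itv.
have /andP[tau_ge tau_le] := natr_ceil_bounds tauE.
have /andP[B_ge _] := natr_ceil_bounds BszE.
have db0 : 0 < delta * beta1 by exact: mulr_gt0.
have tau0 : (0 < tau)%N.
  by rewrite -(ltr0n R); apply: lt_le_trans tau_ge; rewrite divr_gt0// mulr_gt0// mulr_gt0.
have B0 : (0 < Bsz)%N.
  by rewrite -(ltr0n R); apply: lt_le_trans B_ge; rewrite divr_gt0.
have [eta0 eta_ok] := stepsize_le L0 delta_itv b0 (ler0n R tau).
rewrite -etaE in eta0 eta_ok.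
have inf_le y : inf (range f) <= f y.
  by apply: ge_inf; [exists c0 => _ [z _ <-]; exact: fc0|exists y].
have G0_le : psqnorm (gradf x0) <= 2 * L * Delta.
  by rewrite DeltaE; exact: psqnorm_gradient_le.
pose U := exp_grad P xi gradf gradF x0 svdP svdQ tau Bsz beta1 eta.
have bound : 13 / 32 * delta * (\sum_(0 <= t < T) U t) <=
    2 * (Delta / eta) + 21 * (T%:R * (beta1 * sigma ^+ 2)) + 2 * L * Delta / beta1.
  rewrite -sig2.
  apply: (@summation_bound R U (exp_move P xi gradF x0 svdP svdQ tau Bsz beta1 eta)
    (exp_err P xi gradf gradF x0 svdP svdQ tau Bsz beta1 eta)
    (exp_compl P xi gradf gradF x0 svdP svdQ tau Bsz beta1 eta)
    L beta1 delta eta (psqnorm (gradf x0)) _ Bsz%:R Delta tau) => //.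
  - by move=> t; exact: exp_grad_ge0.
  - by move=> t; exact: exp_move_ge0.
  - by move=> t; exact: exp_err_ge0.
  - exact: sigma2_ge0.
  - by rewrite ltr0n.
  - by apply: (exp_err_init (D := D) (L := L)).
  - by move=> t; apply: (exp_err_refresh (D := D)).
  - by move=> t; apply: (exp_err_lazy (D := D)).
  - by move=> t; apply: (exp_compl_le_grad (D := D) (L := L) (sigma_l := sigma_l)).
  - by move=> k t; apply: (exp_compl_le (D := D)).
  - by move=> k t; apply: (exp_grad_drift (D := D) (sigma_l := sigma_l)).
  - by move=> T'; rewrite DeltaE; apply: (exp_descent (D := D) (sigma_l := sigma_l)).
(* Square integrability of the gradients turns the extended expectations into real numbers. *)
have -> : (T%:R^-1%:E * \sum_(t < T) \int[P]_w (psqnorm (gradf (galore_iter beta1 eta tau Bsz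
    gradF svdP svdQ (fun t' b => xi (t', b) w) x0 t)))%:E =
    (T%:R^-1 * \sum_(0 <= t < T) U t)%:E)%E.
  rewrite EFinM big_mkord -sumEFin; congr (_ * _)%E; apply: eq_bigr => t _.
  rewrite /U /exp_grad -EFin_Rexp//.
  by apply: (rintegrable_tgrad (D := D) (L := L) (sigma_l := sigma_l)).
rewrite lee_fin.
apply: (final_rate (A := eta^-1)) => //.
- exact: sqr_ge0.
- rewrite -/q -beta1E etaE invrK deltas; apply: inv_stepsize_le => //.
  by rewrite -deltas.
- by rewrite -/q -beta1E -deltas.
Qed.
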